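(* Let $H:(0,\infty)\to\mathbb C^{2n\times2n}$ be locally integrable with $H\ge0$ a.e. and $0$ a regular endpoint. Let $\alpha=(\alpha_1\ \alpha_2),\beta=(\beta_1\ \beta_2)\in\mathbb C^{n\times2n}$ with $\alpha\alpha^*=I=\beta\beta^*$, $\alpha J\alpha^*=0=\beta J\beta^*$. Suppose that for some $L>0$, $H(x)=P:=\begin{pmatrix}\beta_1^*\beta_1&\beta_1^*\beta_2\\ \beta_2^*\beta_1&\beta_2^*\beta_2\end{pmatrix}$ for $x>L$. Let $\mathcal S=\{(f,g)\in L_H^2(0,\infty)^2: f$ has an absolutely continuous representative $f_0$ with $Jf_0'=-Hg$ a.e. on $(0,\infty)$ and $\alpha f_0(0)=0\}$. Then, under the identification $L^2_H(0,\infty)=L^2_H(0,L)\oplus L^2_H(L,\infty)$, $\mathcal S=\mathcal S^{\alpha,\beta}(0,L)\oplus\{(0,g):g\in L^2_H(L,\infty)\}$. If $H$ is definite on $(0,L)$, then both deficiency indices of $H$ on $(0,\infty)$ equal $n$, the operator parts of $\mathcal S$ and $\mathcal S^{\alpha,\beta}(0,L)$ coincide, and the $m$ functions of $\mathcal S$ and $\mathcal S^{\alpha,\beta}(0,L)$ are the same.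
   Context: $J=\begin{pmatrix}0&-I_n\\ I_n&0\end{pmatrix}$. Regular endpoint $0$: $H\in L^1(0,c)$ for some $c>0$. $H$ definite on an interval: $H(x)v=0$ a.e. there implies $v=0$. $L_H^2(I)$: measurable $f$ with $\int_I f^*Hf<\infty$ modulo null functions. $\mathcal S^{\alpha,\beta}(0,L)=\{(f,g)\in L^2_H(0,L)^2:f$ has an absolutely continuous representative $f_0$ with $Jf_0'=-Hg$ a.e. on $(0,L)$, $\alpha f_0(0)=0=\beta f_0(L)\}$. Deficiency indices: $\dim\ker(\mathcal T\mp i)$ for the maximal relation $\mathcal T$ on $(0,\infty)$. The operator part of a self-adjoint relation $\mathcal R$ is $\mathcal R\cap(\overline{D(\mathcal R)}\oplus\overline{D(\mathcal R)})$. With $u,v$ the matrix solutions of $Ju'=-zHu$, $u(0,z)=-J\alpha^*$, $v(0,z)=\alpha^*$: the $m$ function of $\mathcal S$ at $z\notin\mathbb R$ is the unique $m(z)$ with the columns of $v+um(z)$ in $L^2_H(0,\infty)$, and the $m$ function of $\mathcal S^{\alpha,\beta}(0,L)$ is the unique $m(z)$ with $\beta(v(L,z)+u(L,z)m(z))=0$. *)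

(* Defs.v *)
From HB Require Import structures.
From mathcomp Require Import all_boot all_order all_algebra.
From mathcomp Require Import all_classical all_reals all_analysis.
From mathcomp Require Import complex.
Set Implicit Arguments. Unset Strict Implicit. Unset Printing Implicit Defensive.
Import Order.TTheory GRing.Theory Num.Theory.
Import numFieldNormedType.Exports.
Local Open Scope classical_set_scope.
Local Open Scope ring_scope.

Section CanonicalSystems.
Context {R : realType}.
Local Notation C := (R[i]).
Local Notation mu := (@lebesgue_measure R).

Definition adjmx m p (A : 'M[C]_(m, p)) : 'M[C]_(p, m) := (map_mx (@conjc R) A)^T.

Definition Jmx (n : nat) : 'M[C]_(n + n) := block_mx 0 (- 1%:M) 1%:M 0.

Definition psdmx m (A : 'M[C]_m) : Prop :=
  forall v : 'cV[C]_m, 0 <= (adjmx v *m A *m v) 0 0.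

Definition cintegrable (D : set R) (h : R -> C) : Prop :=
  mu.-integrable D (fun x => (complex.Re (h x))%:E) /\ mu.-integrable D (fun x => (complex.Im (h x))%:E).
Definition cmeasurable (D : set R) (h : R -> C) : Prop :=
  measurable_fun D (fun x => complex.Re (h x)) /\ measurable_fun D (fun x => complex.Im (h x)).

Definition loc_integrable_0oo m (H : R -> 'M[C]_m) : Prop :=
  forall a b : R, 0 < a -> a <= b -> forall i j, cintegrable `[a, b] (fun x => H x i j).

Definition regular_endpoint0 m (H : R -> 'M[C]_m) : Prop :=
  exists2 c : R, 0 < c & forall i j, cintegrable `]0, c[ (fun x => H x i j).

Definition definite_on m (D : set R) (H : R -> 'M[C]_m) : Prop :=
  forall v : 'cV[C]_m, {ae mu, forall x, D x -> H x *m v = 0} -> v = 0.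

Definition Hform m (H : R -> 'M[C]_m) (f g : R -> 'cV[C]_m) (x : R) : C :=
  (adjmx (f x) *m H x *m g x) 0 0.

Definition Hnorm2 m (D : set R) (H : R -> 'M[C]_m) (f : R -> 'cV[C]_m) : \bar R :=
  (\int[mu]_(x in D) (complex.Re (Hform H f f x))%:E)%E.

(** f is (a representative of an element) in L^2_H(D) *)
Definition L2H m (D : set R) (H : R -> 'M[C]_m) (f : R -> 'cV[C]_m) : Prop :=
  (forall i, cmeasurable D (fun x => f x i 0)) /\ (Hnorm2 D H f < +oo)%E.

Definition Hnull m (D : set R) (H : R -> 'M[C]_m) (f : R -> 'cV[C]_m) : Prop :=
  Hnorm2 D H f = 0%E.

(** f and g represent the same element of L^2_H(D) *)
Definition Hequiv m (D : set R) (H : R -> 'M[C]_m) (f g : R -> 'cV[C]_m) : Prop :=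
  Hnull D H (fun x => f x - g x).

Definition rAC (a b : R) (h : R -> R) : Prop :=
  forall e : R, 0 < e -> exists2 d : R, 0 < d &
    forall (k : nat) (s t : nat -> R),
      (forall i, (i < k)%N -> [/\ a <= s i, s i <= t i & t i <= b]) ->
      (forall i j, (i < j < k)%N -> t i <= s j) ->
      \sum_(i < k) (t i - s i) < d ->
      \sum_(i < k) `|h (t i) - h (s i)| < e.

Definition mAC m p (a b : R) (F : R -> 'M[C]_(m, p)) : Prop :=
  forall i j, rAC a b (fun x => complex.Re (F x i j)) /\ rAC a b (fun x => complex.Im (F x i j)).

Definition mderiv m p (F : R -> 'M[C]_(m, p)) (x : R) (dF : 'M[C]_(m, p)) : Prop :=
  forall i j, is_derive x 1 (fun t => complex.Re (F t i j)) (complex.Re (dF i j)) /\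
              is_derive x 1 (fun t => complex.Im (F t i j)) (complex.Im (dF i j)).

Definition canon_eq n p (D : set R) (H : R -> 'M[C]_(n + n))
    (F G : R -> 'M[C]_(n + n, p)) : Prop :=
  {ae mu, forall x, D x -> exists dF, mderiv F x dF /\ Jmx n *m dF = - (H x *m G x)}.

Definition Tmax n (H : R -> 'M[C]_(n + n)) (f g : R -> 'cV[C]_(n + n)) : Prop :=
  L2H `]0, +oo[ H f /\ L2H `]0, +oo[ H g /\
  exists f0 : R -> 'cV[C]_(n + n),
    [/\ forall a b : R, 0 < a -> a <= b -> mAC a b f0,
        Hequiv `]0, +oo[ H f f0 & canon_eq `]0, +oo[ H f0 g].

Definition Srel n (H : R -> 'M[C]_(n + n)) (alpha : 'M[C]_(n, n + n))
    (f g : R -> 'cV[C]_(n + n)) : Prop :=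
  L2H `]0, +oo[ H f /\ L2H `]0, +oo[ H g /\
  exists f0 : R -> 'cV[C]_(n + n),
    [/\ forall b : R, 0 < b -> mAC 0 b f0,
        Hequiv `]0, +oo[ H f f0, canon_eq `]0, +oo[ H f0 g
      & alpha *m f0 0 = 0].

Definition Sab n (H : R -> 'M[C]_(n + n)) (alpha beta : 'M[C]_(n, n + n)) (L : R)
    (f g : R -> 'cV[C]_(n + n)) : Prop :=
  L2H `]0, L[ H f /\ L2H `]0, L[ H g /\
  exists f0 : R -> 'cV[C]_(n + n),
    [/\ mAC 0 L f0, Hequiv `]0, L[ H f f0, canon_eq `]0, L[ H f0 g,
        alpha *m f0 0 = 0 & beta *m f0 L = 0].

(** a subspace K of L^2_H(D) (given by representatives) has dimension k *)
Definition Hdim m (D : set R) (H : R -> 'M[C]_m)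
    (K : (R -> 'cV[C]_m) -> Prop) (k : nat) : Prop :=
  exists F : 'I_k -> R -> 'cV[C]_m,
    [/\ forall j, K (F j),
        forall c : 'I_k -> C, Hnull D H (fun x => \sum_j c j *: F j x) -> forall j, c j = 0
      & forall f, K f -> exists c : 'I_k -> C, Hequiv D H f (fun x => \sum_j c j *: F j x)].

Definition deficiency_index n (H : R -> 'M[C]_(n + n)) (z : C) (k : nat) : Prop :=
  Hdim `]0, +oo[ H (fun f => Tmax H f (fun x => z *: f x)) k.

Definition rel_dom m (S : (R -> 'cV[C]_m) -> (R -> 'cV[C]_m) -> Prop) (f : R -> 'cV[C]_m) : Prop :=
  exists g, S f g.
Definition Hclosure m (D : set R) (H : R -> 'M[C]_m) (P : (R -> 'cV[C]_m) -> Prop)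
    (h : R -> 'cV[C]_m) : Prop :=
  L2H D H h /\ forall e : R, 0 < e ->
    exists2 f, P f & (Hnorm2 D H (fun x => (h x - f x)%R) < e%:E)%E.
Definition op_part m (D : set R) (H : R -> 'M[C]_m)
    (S : (R -> 'cV[C]_m) -> (R -> 'cV[C]_m) -> Prop) (f g : R -> 'cV[C]_m) : Prop :=
  [/\ S f g, Hclosure D H (rel_dom S) f & Hclosure D H (rel_dom S) g].

Definition msol n (H : R -> 'M[C]_(n + n)) (z : C) (init : 'M[C]_(n + n, n))
    (u : R -> 'M[C]_(n + n, n)) : Prop :=
  [/\ forall b : R, 0 < b -> mAC 0 b u, u 0 = init
    & canon_eq `]0, +oo[ H u (fun x => z *: u x)].

Definition unique_sol T (P : T -> Prop) (M : T) : Prop := P M /\ forall M', P M' -> M' = M.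

Definition is_m_S n (H : R -> 'M[C]_(n + n)) (u v : R -> 'M[C]_(n + n, n)) (M : 'M[C]_n) : Prop :=
  unique_sol (fun M' : 'M[C]_n => forall j : 'I_n,
     L2H `]0, +oo[ H (fun x => col j (v x + u x *m M'))) M.

Definition is_m_Sab n (beta : 'M[C]_(n, n + n)) (L : R) (u v : R -> 'M[C]_(n + n, n))
    (M : 'M[C]_n) : Prop :=
  unique_sol (fun M' : 'M[C]_n => beta *m (v L + u L *m M') = 0) M.

End CanonicalSystems.

(* Main.v *)
Require Import Defs.
From HB Require Import structures.
From mathcomp Require Import all_boot all_order all_algebra.
From mathcomp Require Import all_classical all_reals all_analysis.
From mathcomp Require Import complex.
From mathcomp Require Import measurable_realfun ring lra.
Import Order.TTheory GRing.Theory Num.Theory.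
Import numFieldNormedType.Exports.
Local Open Scope classical_set_scope.
Local Open Scope ring_scope.
Set Implicit Arguments. Unset Strict Implicit. Unset Printing Implicit Defensive.

(** On [(L, oo)] the equation reads [f' = J beta^* beta g], so [beta J beta^* = 0] makes [beta f]
    constant there; as [f^* H f = |beta f|^2], square integrability forces [beta f = 0] on
    [[L, oo)], which is the boundary condition at [L].  Conversely a solution on [(0, L)] with
    [beta f(L) = 0] is prolonged by [f(L) + int_L^x J beta^* beta g].  The same remark shows that
    [v + u M] has square integrable columns iff [beta (v(L) + u(L) M) = 0], and that the kernel
    of [T - z] is the space of solutions with [f(L)] in [ker beta], the range of [J beta^*],
    which definiteness embeds into [L^2_H].  The fundamental matrix is built by Picard iteration
    in a weighted sup norm; constancy of the Wronskian [U(zbar)^* J U(z)] gives its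
    invertibility and the uniqueness of solutions, so that no Gronwall estimate for arbitrary
    solutions is needed. *)

(** Every constancy claim rests on one fact: an absolutely continuous function whose derivative
    vanishes a.e. is constant. It is proved straight from the epsilon-delta definition by a covering
    argument, so a given solution never has to be rewritten as the integral of its derivative;
    Lebesgue differentiation is used only for functions constructed as primitives. Two features of
    the definitions shape the rest. Elements of L^2_H are classes, and [H] may be singular, so a
    representative is known only through [H x *m f x]; positivity makes norm zero equivalent to
    [H x *m f x = 0] a.e., and all identities of classes are read in that form. Moreover the
    representatives in [Tmax] are absolutely continuous only on compact subintervals of (0, oo),
    with no value at 0 to start from. Solutions are therefore compared from [L] to the left. *)

Section AbsolutelyContinuous.
Context {R : realType}.
Local Notation mu := (@lebesgue_measure R).
Implicit Types (a b c x y : R) (f g h : R -> R).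

(** A single domination criterion behind the closure properties: sums, multiples, products and
    exponentials only have to bound their increments by those of their ingredients. The [+ 1] in the
    tolerance [e / (2 * (M + 1))] lets [M] be zero. *)
Lemma rAC_dom a b f g h (M : R) : 0 <= M ->
  (forall x y, a <= x -> x <= y -> y <= b ->
     `|h y - h x| <= M * (`|f y - f x| + `|g y - g x|)) ->
  rAC a b f -> rAC a b g -> rAC a b h.
Proof.
move=> M0 hM cf cg e e0.
have e'0 : 0 < e / (2 * (M + 1)) by rewrite divr_gt0// mulr_gt0//; lra.
have [df df0 Hf] := cf _ e'0; have [dg dg0 Hg] := cg _ e'0.
exists (Num.min df dg) => [|k s t st ord]; first by rewrite lt_min df0.
rewrite lt_min => /andP[/(Hf _ _ _ st ord) sf /(Hg _ _ _ st ord) sg].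
apply: (@le_lt_trans _ _ (M * (\sum_(i < k) `|f (t i) - f (s i)| +
                             \sum_(i < k) `|g (t i) - g (s i)|))).
  rewrite -big_split/= mulr_sumr; apply: ler_sum => i _.
  by have [] := st i (ltn_ord i) => *; exact: hM.
apply: (@le_lt_trans _ _ (M * (e / (2 * (M + 1)) + e / (2 * (M + 1))))).
  by rewrite ler_wpM2l// ltW// ltrD.
rewrite -mulrDl mulrA ltr_pdivrMr; last by lra.
by nra.
Qed.

Lemma rAC_cst a b (k : R) : rAC a b (fun=> k).
Proof.
move=> e e0; exists 1 => // n s t _ _ _.
by rewrite big1// => i _; rewrite subrr normr0.
Qed.

Lemma rACD a b f g : rAC a b f -> rAC a b g -> rAC a b (fun x => f x + g x).
Proof.
apply: (@rAC_dom _ _ _ _ _ 1) => // x y _ _ _.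
by rewrite mul1r opprD addrACA ler_normD.
Qed.

Lemma rACZ a b f (k : R) : rAC a b f -> rAC a b (fun x => k * f x).
Proof.
move=> cf; apply: (@rAC_dom _ _ f f _ `|k|) => // x y _ _ _.
by rewrite -mulrBr normrM ler_wpM2l// lerDl.
Qed.

Lemma rACN a b f : rAC a b f -> rAC a b (fun x => - f x).
Proof.
by move=> /(rACZ (-1)); under eq_fun do rewrite mulN1r.
Qed.

Lemma rACB a b f g : rAC a b f -> rAC a b g -> rAC a b (fun x => f x - g x).
Proof. by move=> cf cg; apply: rACD => //; exact: rACN. Qed.

Lemma rACS a b a' b' f : a <= a' -> b' <= b -> rAC a b f -> rAC a' b' f.
Proof.
move=> aa' bb' cf e e0; have [d d0 Hd] := cf e e0; exists d => // k s t st.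
apply: Hd => i ik; have [? ? ?] := st i ik.
by split => //; [exact: (le_trans aa')|exact: (le_trans _ bb')].
Qed.

Lemma rAC_eq a b f g : (forall x, a <= x <= b -> f x = g x) ->
  rAC a b f -> rAC a b g.
Proof.
move=> fg cf e e0; have [d d0 Hd] := cf e e0; exists d => // k s t st o kd.
rewrite (eq_bigr (fun i : 'I_k => `|f (t i) - f (s i)|)) ?Hd// => i _.
have [asi sti tib] := st i (ltn_ord i).
by rewrite !fg// ?asi ?tib ?andbT//= ?(le_trans asi sti) ?(le_trans sti tib).
Qed.

Lemma minr_incr a b c : a <= b -> 0 <= Num.min b c - Num.min a c <= b - a.
Proof.
by move=> ab; rewrite /Order.min; repeat case: ifPn; rewrite -?leNgt => *;
  apply/andP; split; lra.
Qed.

Lemma maxr_incr a b c : a <= b -> 0 <= Num.max b c - Num.max a c <= b - a.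
Proof.
by move=> ab; rewrite /Order.max; repeat case: ifPn; rewrite -?leNgt => *;
  apply/andP; split; lra.
Qed.

(** An interval of the family may straddle [b]. Taking the minimum, respectively the maximum, of all
    endpoints with [b] cuts each interval into its two parts without reindexing; both maps are
    monotone and 1-Lipschitz, so order and total length are preserved well enough, and intervals on
    the wrong side become points. *)
Lemma rAC_glue a b c f : a <= b -> b <= c ->
  rAC a b f -> rAC b c f -> rAC a c f.
Proof.
move=> ab bc c1 c2 e e0; have e20 : 0 < e / 2 by rewrite divr_gt0.
have [d1 d10 H1] := c1 _ e20; have [d2 d20 H2] := c2 _ e20.
exists (Num.min d1 d2) => [|k s t st ord]; first by rewrite lt_min d10.
rewrite lt_min => /andP[k1 k2].
have s1 : \sum_(i < k) `|f (Num.min (t i) b) - f (Num.min (s i) b)| < e / 2.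
  apply: (H1 k (fun i => Num.min (s i) b) (fun i => Num.min (t i) b)).
  - move=> i ik; have [asi sti tic] := st i ik; have := minr_incr b sti.
    by rewrite subr_ge0 => /andP[-> _]; rewrite le_min asi ab ge_min lexx orbT.
  - by move=> i j ij; have := minr_incr b (ord i j ij); rewrite subr_ge0 => /andP[].
  - apply: le_lt_trans k1; apply: ler_sum => i _.
    by have [_ sti _] := st i (ltn_ord i); have /andP[] := minr_incr b sti.
have s2 : \sum_(i < k) `|f (Num.max (t i) b) - f (Num.max (s i) b)| < e / 2.
  apply: (H2 k (fun i => Num.max (s i) b) (fun i => Num.max (t i) b)).
  - move=> i ik; have [asi sti tic] := st i ik; have := maxr_incr b sti.
    by rewrite subr_ge0 => /andP[-> _]; rewrite ge_max tic bc le_max lexx orbT.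
  - by move=> i j ij; have := maxr_incr b (ord i j ij); rewrite subr_ge0 => /andP[].
  - apply: le_lt_trans k2; apply: ler_sum => i _.
    by have [_ sti _] := st i (ltn_ord i); have /andP[] := maxr_incr b sti.
apply: (@le_lt_trans _ _ (\sum_(i < k)
   (`|f (Num.min (t i) b) - f (Num.min (s i) b)| +
    `|f (Num.max (t i) b) - f (Num.max (s i) b)|))); last first.
  by rewrite big_split/= (splitr e) ltrD.
apply: ler_sum => i _; have [_ sti _] := st i (ltn_ord i).
have [tb|/ltW bt] := leP (t i) b.
  by rewrite (min_idPl (le_trans sti tb)) lerDl.
have [sb|/ltW bs] := leP (s i) b.
  by have := ler_normD (f (t i) - f b) (f b - f (s i)); rewrite subrKA [leRHS]addrC.
by rewrite subrr normr0 add0r.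
Qed.

Lemma rAC_unif a b f : rAC a b f -> forall e, 0 < e -> exists2 d, 0 < d &
  forall x y, a <= x -> x <= y -> y <= b -> y - x < d -> `|f y - f x| < e.
Proof.
move=> cf e e0; have [d d0 Hd] := cf e e0; exists d => // x y ax xy yb yxd.
have := Hd 1%N (fun=> x) (fun=> y); rewrite !big_ord1; apply => //.
by move=> i [|j]; rewrite ?ltn0// !ltnS leqn0 andbC; case: j.
Qed.

Lemma rAC_continuous a b f x : rAC a b f -> a < x < b -> {for x, continuous f}.
Proof.
move=> /rAC_unif cf /andP[ax xb].
apply/cvgrPdist_lt => e e0; have [d d0 Hd] := cf e e0.
near=> y.
have : `|x - y| < d by near: y; exact: cvgr_dist_lt.
have ay : a < y by near: y; exact: lt_nbhsr.
have yb : y < b by near: y; exact: lt_nbhsl.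
have [xy|/ltW yx] := leP x y; last first.
  by rewrite ger0_norm ?subr_ge0// => ?; apply: Hd => //; exact: ltW.
rewrite distrC ger0_norm ?subr_ge0// => ?.
by rewrite distrC; apply: Hd => //; exact: ltW.
Unshelve. all: by end_near. Qed.

Lemma rAC_bounded a b f : rAC a b f ->
  exists2 M, 0 <= M & forall x, a <= x <= b -> `|f x| <= M.
Proof.
move=> /rAC_unif cf; have [ab|ba] := leP a b; last first.
  by exists 0 => // x /andP[ax /(le_trans ax)]; rewrite leNgt ba.
(* Clamping is monotone and 1-Lipschitz, so [f \o cl] is continuous on the whole line although
   nothing is known of [f] outside [[a, b]]; its extreme values bound [f]. *)
pose cl x := Num.max a (Num.min x b).
have cfc : continuous (f \o cl).
  move=> x; apply/cvgrPdist_lt => e e0; have [d d0 Hd] := cf e e0.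
  near=> y.
  have : `|x - y| < d by near: y; exact: cvgr_dist_lt.
  have acl z : a <= cl z by rewrite le_max lexx.
  have clb z : cl z <= b by rewrite ge_max ab ge_min lexx orbT.
  have cll u v : u <= v -> 0 <= cl v - cl u <= v - u.
    move=> uv; have /andP[m0 m1] := minr_incr b uv; rewrite /cl !(maxC a).
    have /andP[-> /le_trans ->//] := maxr_incr a (etrans (esym (subr_ge0 _ _)) m0).
  have [xy|/ltW yx] := leP x y; last first.
    rewrite ger0_norm ?subr_ge0// => ?; have /andP[] := cll _ _ yx.
    by rewrite subr_ge0 => ? /le_lt_trans ?; apply: Hd; auto.
  rewrite distrC ger0_norm ?subr_ge0// => ?; have /andP[] := cll _ _ xy.
  by rewrite distrC subr_ge0 => ? /le_lt_trans ?; apply: Hd; auto.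
have wc : {within `[a, b], continuous (f \o cl)} by exact: continuous_subspaceT.
have [u _ Hu] := EVT_max ab wc; have [v _ Hv] := EVT_min ab wc.
exists (Num.max `|f (cl u)| `|f (cl v)|) => [|x axb]; first by rewrite le_max normr_ge0.
have clx : cl x = x by case/andP: axb => ax xb; rewrite /cl (min_idPl xb) (max_idPr ax).
have xI : x \in `[a, b] by rewrite in_itv.
have := Hu _ xI; have := Hv _ xI; rewrite /= clx => h1 h2.
rewrite le_max.
have [p|/ltW p] := leP 0 (f x).
  by rewrite ger0_norm// (le_trans h2 (ler_norm _)).
by rewrite ler0_norm// orbC -[in X in X || _]normrN (le_trans _ (ler_norm _))// lerN2.
Unshelve. all: by end_near. Qed.

Lemma rACM a b f g : rAC a b f -> rAC a b g -> rAC a b (fun x => f x * g x).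
Proof.
move=> cf cg; have [M M0 Mf] := rAC_bounded cf; have [N N0 Ng] := rAC_bounded cg.
apply: (@rAC_dom _ _ f g _ (M + N)) => //; first exact: addr_ge0.
move=> x y ax xy yb.
have -> : f y * g y - f x * g x = (f y - f x) * g y + f x * (g y - g x) by ring.
rewrite (le_trans (ler_normD _ _))// !normrM.
have gy : `|g y| <= N by apply: Ng; rewrite yb (le_trans ax).
have fx : `|f x| <= M by apply: Mf; rewrite ax (le_trans xy).
have := normr_ge0 (f y - f x); have := normr_ge0 (g y - g x).
by nra.
Qed.


(* Cousin's lemma in disguise: the points of [[a, b]] for which the conclusion holds form an
   open and closed set. *)
Lemma rAC_small a b f (O : set R) (e : R) : a <= b -> 0 < e -> open O ->
  (forall x, a <= x <= b -> O x \/ is_derive x 1 f 0) ->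
  exists (k : nat) (s t : nat -> R),
    [/\ forall i, (i < k)%N -> [/\ a <= s i, s i <= t i & t i <= b],
        forall i j, (i < j < k)%N -> t i <= s j,
        ((\sum_(i < k) (t i - s i))%:E <= mu (O `&` `]a, b]))%E &
        `|f b - f a| <= e * (b - a) + \sum_(i < k) `|f (t i) - f (s i)|].
Proof.
move=> ab e0 oO HO.
(* The increment of [f] is charged in two ways: on stretches inside [O] to intervals whose total
   length is paid for by the measure of [O], elsewhere to the slope [e]. [step_O] and [step_der]
   extend the account by one stretch of either kind. *)
pose P x := exists (k : nat) (s t : nat -> R),
    [/\ forall i, (i < k)%N -> [/\ a <= s i, s i <= t i & t i <= x],
        forall i j, (i < j < k)%N -> t i <= s j,
        ((\sum_(i < k) (t i - s i))%:E <= mu (O `&` `]a, x]))%E &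
        `|f x - f a| <= e * (x - a) + \sum_(i < k) `|f (t i) - f (s i)|].
have Pa : P a.
  exists 0%N, (fun=> 0), (fun=> 0); split => //.
  - by rewrite big_ord0 measure_ge0.
  - by rewrite !subrr mulr0 normr0 big_ord0 addr0.
have step_der x y : a <= x -> x <= y -> `|f y - f x| <= e * (y - x) -> P x -> P y.
  move=> ax xy fxy [k [s [t [st o m v]]]]; exists k, s, t; split => //.
  - by move=> i /st[? ? tx]; split => //; exact: (le_trans tx).
  - apply: (le_trans m); apply: le_measure; rewrite ?inE.
    + by apply: measurableI => //; exact: open_measurable.
    + by apply: measurableI => //; exact: open_measurable.
    + by apply: setIS; apply: subset_itvl; rewrite bnd_simp.
  - have := ler_normD (f y - f x) (f x - f a); rewrite subrKA => /le_trans; apply.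
    by rewrite (le_trans (lerD fxy v))// addrA -mulrDr subrKA.
have step_O x y : a <= x -> x <= y -> `]x, y] `<=` O -> P x -> P y.
  move=> ax xy xyO [k [s [t [st o m v]]]].
  exists k.+1, (fun i => if (i < k)%N then s i else x), (fun i => if (i < k)%N then t i else y).
  have big F : \sum_(i < k.+1) F (if (i < k)%N then t i else y) (if (i < k)%N then s i else x)
      = \sum_(i < k) F (t i) (s i) + F y x :> R.
    rewrite big_ord_recr/= ltnn; congr (_ + _).
    by apply: eq_bigr => i _; rewrite ltn_ord.
  split.
  - move=> i; case: ifPn => [/st[? ? tx] _|_ _]; last by split.
    by split => //; exact: (le_trans tx).
  - move=> i j /andP[ij]; rewrite ltnS => jk; rewrite (leq_trans ij jk).
    case: ifPn => jk'; first by apply: o; rewrite ij.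
    by have [] := st i (leq_trans ij jk).
  - rewrite (big (fun p q => p - q)) EFinD.
    have -> : O `&` `]a, y] = (O `&` `]a, x]) `|` `]x, y].
      rewrite (@itv_bndbnd_setU _ _ _ (BRight x)) ?bnd_simp// setIUr; congr (_ `|` _).
      exact/setIidr.
    rewrite measureU//.
    + rewrite leeD// [leRHS]lebesgue_measure_itv/= lte_fin.
      case: ifPn => // xy'.
      by rewrite lee_fin subr_le0 leNgt.
    + by apply: measurableI => //; exact: open_measurable.
    + rewrite -subset0 => z /= [[_]]; rewrite !in_itv/= => /andP[_ zx] /andP[xz _].
      by move: xz; rewrite ltNge zx.
  - rewrite (big (fun p q => `|f p - f q|)).
    have := ler_normD (f y - f x) (f x - f a); rewrite subrKA => /le_trans; apply.
    rewrite addrC addrA lerD2r (le_trans v)// lerD2r ler_wpM2l ?(ltW e0)//.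
    by rewrite lerD2r.
(* The passage from [x] to [y] straddles [c], which gives both halves of the supremum argument: the
   supremum is reached, and it can be exceeded. At a point of zero derivative both increments are
   measured from [c]. *)
have local c : a <= c <= b -> exists2 r, 0 < r & forall x y, a <= x ->
    c - r < x -> x <= c -> c <= y -> y < c + r -> P x -> P y.
  move=> /HO[Oc|dc].
  - have [r /= r0 rO] : nbhs c O by exact: open_nbhs_nbhs.
    exists r => // x y ax cx xc cy yc; apply: step_O => //; first exact: le_trans cy.
    move=> z /=; rewrite in_itv/= => /andP[xz zy]; apply: rO => /=.
    by rewrite ltr_distlC; apply/andP; split; lra.
  - have [df Ef] := dc.
    have cvf : h^-1 *: (f (h *: 1 + c) - f c) @[h --> (0:R)^'] --> 'D_1 f c.
      exact: df.
    rewrite Ef in cvf.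
    move/cvgrPdist_lt : cvf => /(_ e e0)[r /= r0 Hr].
    have Hc z : `|z - c| < r -> `|f z - f c| <= e * `|z - c|.
      have [->|zc] := eqVneq z c; first by rewrite !subrr !normr0 mulr0.
      move=> zr; have zc0 : z - c != 0 by rewrite subr_eq0.
      have := Hr (z - c); rewrite /= sub0r normrN zr => /(_ erefl zc0).
      rewrite sub0r normrN [_ *: 1]mulr1 subrK normrM normfV => /ltW.
      by rewrite ler_pdivrMl ?normr_gt0// mulrC.
    exists r => // x y ax cx xc cy yc; apply: step_der => //; first exact: le_trans cy.
    have := ler_normD (f y - f c) (f c - f x); rewrite subrKA => /le_trans; apply.
    rewrite -[_ - f x]opprB normrN.
    rewrite (le_trans (lerD (Hc y _) (Hc x _)))//.
    + by rewrite ger0_norm ?subr_ge0//; lra.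
    + by rewrite distrC ger0_norm ?subr_ge0//; lra.
    + rewrite (ger0_norm (_ : 0 <= y - c)) ?subr_ge0//.
      by rewrite (ler0_norm (_ : x - c <= 0)) ?subr_le0//; lra.
pose S := [set x | a <= x <= b /\ P x].
have Sa : S a by split => //; rewrite lexx.
have supS : has_sup S by split; [exists a|exists b => x [/andP[]]].
pose c := sup S.
have ac : a <= c by apply: ub_le_sup => //; exact: supS.2.
have cb : c <= b by apply: ge_sup; [exists a|move=> x [/andP[]]].
have [|r r0 Hr] := local c; first by rewrite ac.
have [x [/andP[ax xb] Px] cx] := sup_adherent r0 supS.
have xc : x <= c by apply: ub_le_sup; [exact: supS.2|split => //; rewrite ax].
suff cEb : c = b.
  by rewrite -cEb; apply: (Hr x c ax cx xc (lexx _) _ Px); rewrite ltrDl.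
apply/eqP; rewrite eq_le cb/= leNgt; apply/negP => ltcb.
pose y := Num.min b (c + r / 2).
have cy : c < y by rewrite lt_min ltcb ltrDl divr_gt0.
have Py : P y.
  apply: (Hr x y ax cx xc (ltW cy) _ Px).
  by rewrite gt_min ltrD2l ltr_pdivrMr// ltr_pMr// ltr1n orbT.
have : y <= c.
  apply: ub_le_sup; [exact: supS.2|split => //].
  by rewrite (le_trans ac (ltW cy)) ge_min lexx.
by rewrite leNgt cy.
Qed.

(** Enclose the exceptional null set in an open [V] of measure below the [d] that absolute
    continuity assigns to [e / 2]. The intervals supplied by [rAC_small] have total length below
    [d], so they account for at most [e / 2]; the points of zero derivative account for the other
    half. *)
Lemma rAC_const a b f : a <= b -> rAC a b f ->
  {ae mu, forall x, x \in `]a, b[ -> is_derive x 1 f 0} -> f b = f a.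
Proof.
move=> ab cf [N [mN N0 NP]].
apply/eqP; rewrite -subr_eq0 -normr_le0; apply/ler_addgt0Pl => e e0.
rewrite addr0.
have e20 : 0 < e / 2 by rewrite divr_gt0.
have [d d0 Hd] := cf _ e20.
(* The endpoints join the exceptional set because the derivative is known only inside, while
   [rAC_small] asks about every point of the closed interval. *)
pose N' := N `|` [set a; b].
have mN' : measurable N' by apply: measurableU => //; exact: measurableU.
have N'0 : mu N' = 0%E.
  apply/negligibleP => //; apply: negligibleU; first exact/negligibleP.
  by apply: negligibleU; apply/negligibleP => //; exact: lebesgue_measure_set1.
have [V [oV NsubV Vd]] : exists V : set R, [/\ open V, N' `<=` V & (mu (V `\` N') < d%:E)%E].
  by apply: lebesgue_regularity_outer => //; rewrite [ltLHS]N'0.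
have muV : (mu V < d%:E)%E.
  rewrite (_ : V = (V `\` N') `|` N'); last by rewrite setUC setDUK.
  by rewrite measureU0//; apply: measurableD => //; exact: open_measurable.
(* Chosen so that [e' * (b - a) <= e / 2]; the [+ 1] covers the case [a = b]. *)
pose e' := e / (2 * (b - a + 1)).
have e'0 : 0 < e' by rewrite divr_gt0// mulr_gt0//; lra.
have [|k [s [t [st o m v]]]] := @rAC_small a b f V e' ab e'0 oV.
  move=> x /andP[ax xb]; have [Vx|nVx] := pselect (V x); [by left|right].
  apply: contrapT => nd; apply: nVx; apply: NsubV.
  have [->|xa] := eqVneq x a; first by right; left.
  have [->|xb'] := eqVneq x b; first by right; right.
  left; apply: NP => /= H; apply: nd; apply: H.
  by rewrite in_itv/= !lt_neqAle ax xb xb' eq_sym xa.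
rewrite (le_trans v)// [leRHS]splitr lerD//.
  rewrite /e' -mulrA ler_pM2l// ler_pdivrMl; last by lra.
  by lra.
apply/ltW/(Hd k s t st o); rewrite -lte_fin (le_lt_trans m)// (le_lt_trans _ muV)//.
apply: le_measure; rewrite ?inE//.
- by apply: measurableI => //; exact: open_measurable.
- exact: open_measurable.
Qed.

End AbsolutelyContinuous.

(** * Combining almost-everywhere statements *)

Section AlmostEverywhere.
Context {R : realType}.
Local Notation mu := (@lebesgue_measure R).
Implicit Types P Q : R -> Prop.

Lemma ae_mono P Q : (forall x, P x -> Q x) ->
  {ae mu, forall x, P x} -> {ae mu, forall x, Q x}.
Proof. by move=> PQ; apply: filterS PQ; exact: (ae_filter_ringOfSetsType mu). Qed.

Lemma ae_and P Q : {ae mu, forall x, P x} -> {ae mu, forall x, Q x} ->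
  {ae mu, forall x, P x /\ Q x}.
Proof. by apply: filterI; exact: (ae_filter_ringOfSetsType mu). Qed.

Lemma ae_fin (I : finType) (P : I -> R -> Prop) :
  (forall i, {ae mu, forall x, P i x}) -> {ae mu, forall x i, P i x}.
Proof.
by move=> H; apply: (@filter_forall _ _ _ _ _ H); exact: (ae_filter_ringOfSetsType mu).
Qed.

Lemma ae_neq (c : R) : {ae mu, forall x, x != c}.
Proof.
exists [set c]; split => //; first exact: lebesgue_measure_set1.
by move=> x /= /negP; rewrite negbK => /eqP.
Qed.

End AlmostEverywhere.

(** * Primitives: absolute continuity and Lebesgue differentiation *)

Section Primitive.
Context {R : realType}.
Local Notation mu := (@lebesgue_measure R).
Implicit Types (a b c x y : R) (f g h : R -> R).

(** Starting at -oo avoids case distinctions on the position of [x]; the coefficients and tail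
    integrands used later are cut off to the left of 0 or of [L], so this is the integral from
    there. *)
Definition primitive f x : R := \int[mu]_(t in `]-oo, x]) f t.

(** Integrability is asked on left half-lines only, since the tail integrand [beta g] is square
    integrable near +oo but in general not integrable there. *)
Definition lintegrable f := forall y, mu.-integrable `]-oo, y] (EFin \o f).

Lemma lintegrable_locally f : lintegrable f -> locally_integrable setT f.
Proof.
move=> If; split.
- have -> : [set: R] = \bigcup_(n in setT) `]-oo, (n%:R : R)]%classic.
    apply/seteqP; split => // x _; have [n xn] : exists n : nat, x < n%:R.
      by exists (Num.trunc x).+1; exact: truncnS_gt.
    by exists n => //=; rewrite in_itv/= ltW.
  apply/measurable_fun_bigcup => // n.
  by apply/measurable_EFinP; exact: (measurable_int mu (If n%:R)).
- exact: openT.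
- move=> K _ cK.
  have [M [_ KM]] := compact_bounded cK.
  have /integrableP[mf] := If (`|M| + 1); apply: le_lt_trans.
  apply: ge0_subset_integral => //=.
  - exact: compact_measurable.
  - apply/measurable_EFinP; apply: measurableT_comp => //.
    exact/measurable_EFinP.
  - move=> x Kx /=; rewrite in_itv/=.
    apply: (le_trans (ler_norm _)); apply: KM Kx.
    by rewrite (le_lt_trans (ler_norm _))// ltrDl.
Qed.

Lemma primitiveB f x y : lintegrable f -> x <= y ->
  primitive f y - primitive f x = \int[mu]_(t in `]x, y]) f t.
Proof.
move=> If xy; apply: Rintegral_itvB; rewrite ?bnd_simp//.
Qed.

Lemma primitive_derive f : lintegrable f ->
  {ae mu, forall x, is_derive x 1 (primitive f) (f x)}.
Proof.
move=> If; have := FTC1Ny If (lintegrable_locally If).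
apply: ae_mono => x [df Ef].
by apply: DeriveDef; [exact: df|rewrite -derive1E; exact: Ef].
Qed.

Lemma primitive_rAC f a b : lintegrable f -> rAC a b (primitive f).
Proof.
move=> If e e0.
(* Cutting off at [b] yields a function integrable on the whole line, to which absolute continuity
   of the integral with respect to the measure applies. *)
pose f' := f \_ `]-oo, b].
have If' : mu.-integrable setT (EFin \o f').
  by rewrite -restrict_EFin; apply/integrable_restrict => //; rewrite setTI.
have [d [d0 Hd]] := integral_normr_continuous If' e0.
exists d => // k s t st o sd.
(* Half-open intervals stay disjoint when neighbours of the family share an endpoint, so lengths and
   integrals add up over the union. *)
pose I (i : 'I_k) := `]s i, t i]%classic.
pose A := \big[setU/set0]_(i < k) I i.
have tI : trivIset setT I.
  have tI' (i j : 'I_k) : (i < j)%N -> I i `&` I j = set0.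
    move=> ij; have tisj : t i <= s j by apply: o; rewrite ij ltn_ord.
    rewrite -subset0 => x []; rewrite /I/= !in_itv/= => /andP[_ xt] /andP[sx _].
    by have := lt_le_trans sx (le_trans xt tisj); rewrite ltxx.
  apply/trivIsetP => i j _ _; rewrite neq_ltn => /orP[/tI'//|/tI'].
  by rewrite setIC.
have mI i : measurable (I i) by exact: measurable_itv.
have mA : measurable A by apply: bigsetU_measurable => i _; exact: measurable_itv.
have muA : mu A = (\sum_(i < k) (t i - s i))%:E.
  rewrite /A measure_bigsetU_ord// -sumEFin; apply: eq_bigr => i _.
  have [_ sti _] := st i (ltn_ord i).
  rewrite [LHS]lebesgue_measure_itv/= lte_fin.
  by case: ifPn => // /negP/negP; rewrite -leNgt => ts; congr EFin; lra.
have {}muA : (mu A < d%:E)%E by rewrite muA lte_fin.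
apply: le_lt_trans (Hd A mA muA).
have -> : \int[mu]_(x in A) `|f' x| = \sum_(i < k) \int[mu]_(x in I i) `|f' x|.
  have mf' : measurable_fun setT f' by apply/measurable_EFinP; exact: (measurable_int mu If').
  have Iabs : mu.-integrable setT (fun x => `|f' x|%:E) by exact: (integrable_abse If').
  rewrite /Rintegral ge0_integral_bigsetU ?index_enum_uniq//.
  - rewrite sum_fine// => i _; apply: integrable_fin_num => //.
    + exact: mI.
    + have S : I i `<=` setT by [].
      exact: (@integrableS _ _ _ mu setT (I i) _ measurableT (mI i) S Iabs).
  - by apply: sub_trivIset tI.
  - by apply/measurable_EFinP/measurableT_comp => //; exact: measurable_funTS.
apply: ler_sum => i _; have [asi sti tib] := st i (ltn_ord i).
rewrite primitiveB//.
have -> : \int[mu]_(x in `]s i, t i]) f x = \int[mu]_(x in `]s i, t i]) f' x.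
  apply: eq_Rintegral => x; rewrite inE/= in_itv/= => /andP[_ xt].
  by rewrite /f' patchE mem_set//= in_itv/= (le_trans xt).
by apply: le_normr_Rintegral => //; exact: integrableS If'.
Qed.

End Primitive.

(** * Real integrable functions and estimates of primitives *)

Section RealIntegrable.
Context {R : realType}.
Local Notation mu := (@lebesgue_measure R).
Implicit Types (D : set R) (f g h : R -> R).

Definition rint D f := mu.-integrable D (EFin \o f).

Lemma rint_measurable D f : rint D f -> measurable_fun D f.
Proof. by move=> If; apply/measurable_EFinP; exact: (measurable_int mu If). Qed.

Lemma rintMb D f h (M : R) : measurable D -> rint D f -> measurable_fun D h ->
  (forall x, D x -> `|h x| <= M) -> rint D (fun x => f x * h x).
Proof.
move=> mD If mh hM; rewrite /rint.
have -> : EFin \o (fun x => f x * h x) = ((EFin \o f) \* (EFin \o h))%E by [].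
apply: integrableMl => //.
exists M; split => [|N MN x Dx]; first exact: num_real.
exact: (le_trans (hM x Dx) (ltW MN)).
Qed.

Lemma rint0 D : rint D (fun=> 0).
Proof. exact: integrable0. Qed.

Lemma rintD D f g : measurable D -> rint D f -> rint D g -> rint D (fun x => f x + g x).
Proof. by move=> mD If Ig; exact: (@integrableD _ _ _ mu D mD _ _ If Ig). Qed.

Lemma rintZ D f (k : R) : measurable D -> rint D f -> rint D (fun x => k * f x).
Proof. by move=> mD If; exact: (@integrableZl _ _ _ mu D mD k _ If). Qed.

Lemma rintN D f : measurable D -> rint D f -> rint D (fun x => - f x).
Proof.
by move=> mD /(rintZ (-1) mD); under eq_fun do rewrite mulN1r.
Qed.

Lemma rint_norm D f : measurable D -> rint D f -> rint D (fun x => `|f x|).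
Proof. by move=> mD If; exact: (@integrable_abse _ _ _ mu D _ If). Qed.

Lemma rint_sum D (I : Type) (s : seq I) (F : I -> R -> R) : measurable D ->
  (forall i, rint D (F i)) -> rint D (fun x => \sum_(i <- s) F i x).
Proof.
move=> mD IF; elim: s => [|i s IH].
  by under eq_fun do rewrite big_nil; exact: rint0.
by under eq_fun do rewrite big_cons; exact: rintD.
Qed.

Lemma rintS D E f : measurable D -> measurable E -> E `<=` D -> rint D f -> rint E f.
Proof. by move=> mD mE ED If; exact: (@integrableS _ _ _ mu D E _ mD mE ED If). Qed.

Lemma rint_le D f g : measurable D -> measurable_fun D f ->
  (forall x, D x -> `|f x| <= g x) -> rint D g -> rint D f.
Proof.
move=> mD mf fg Ig.
apply: (@le_integrable _ _ _ mu D mD _ _ _ _ Ig); first exact/measurable_EFinP.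
by move=> x Dx; rewrite lee_fin (le_trans (fg x Dx))// ler_norm.
Qed.

Lemma rint_lintegrable f : rint setT f -> lintegrable f.
Proof. by move=> If y; exact: (rintS measurableT _ _ If). Qed.

Lemma primitive_measurable f : lintegrable f -> measurable_fun setT (primitive f).
Proof.
move=> If; apply: continuous_measurable_fun => x.
apply: (@rAC_continuous _ (x - 1) (x + 1)); first exact: primitive_rAC.
by rewrite ltrBlDr ltrDl ltr01.
Qed.

Lemma primitiveD f g x : lintegrable f -> lintegrable g ->
  primitive (fun t => f t + g t) x = primitive f x + primitive g x.
Proof. by move=> If Ig; rewrite /primitive RintegralD. Qed.

Lemma normr_primitive_le f g x : lintegrable f -> lintegrable g ->
  (forall t, `|f t| <= g t) -> `|primitive f x| <= primitive g x.
Proof.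
move=> If Ig fg; rewrite /primitive.
apply: (@le_trans _ _ (\int[mu]_(t in `]-oo, x]) `|f t|)).
  by apply: le_normr_Rintegral => //; exact: If.
by apply: le_Rintegral => //; exact: (rint_norm _ (If x)).
Qed.

Lemma primitive_eq0 f x : (forall t, t <= x -> f t = 0) -> primitive f x = 0.
Proof.
move=> f0; rewrite /primitive /Rintegral integral0_eq// => t.
by rewrite /= in_itv/= => /f0 ->.
Qed.

Lemma primitive_le_total f x : rint setT f -> (forall t, 0 <= f t) ->
  primitive f x <= \int[mu]_t f t.
Proof.
move=> If f0; apply: fine_le.
- apply: integrable_fin_num; first exact: measurable_itv.
  exact: (rint_lintegrable If).
- exact: integrable_fin_num.
- apply: ge0_subset_integral => //; first exact: (measurable_int mu If).
  by move=> t _; rewrite lee_fin.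
Qed.

End RealIntegrable.

(** * Pointwise rules of derivation *)

Section RealDerivatives.
Context {R : realType}.
Implicit Types (f g : R -> R) (x df dg : R).

Lemma rderD f g x df dg : is_derive x 1 f df -> is_derive x 1 g dg ->
  is_derive x 1 (fun t => f t + g t) (df + dg).
Proof. by move=> ? ?; exact: is_deriveD. Qed.

Lemma rderN f x df : is_derive x 1 f df -> is_derive x 1 (fun t => - f t) (- df).
Proof. by move=> ?; exact: is_deriveN. Qed.

Lemma rderB f g x df dg : is_derive x 1 f df -> is_derive x 1 g dg ->
  is_derive x 1 (fun t => f t - g t) (df - dg).
Proof. by move=> ? ?; exact: is_deriveB. Qed.

Lemma rderM f g x df dg : is_derive x 1 f df -> is_derive x 1 g dg ->
  is_derive x 1 (fun t => f t * g t) (df * g x + f x * dg).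
Proof.
move=> hf hg; have h := is_deriveM hf hg.
by apply: (is_derive_eq h); rewrite addrC [_ *: df]mulrC.
Qed.

Lemma rder_cst x (c : R) : is_derive x 1 (fun=> c) 0.
Proof. exact: is_derive_cst. Qed.

End RealDerivatives.

(** * The exponential weight *)

Section Gronwall.
Context {R : realType}.
Local Notation mu := (@lebesgue_measure R).
Variable a : R -> R.
Hypotheses (a0 : forall x, 0 <= a x) (a_neg : forall x, x <= 0 -> a x = 0)
  (Ia : rint setT a).

(** Weight of the sup norm in which an integral operator with kernel dominated by [a] has norm at
    most 1/2; that 1/2 is the inverse of the factor 2 in the exponent. *)
Definition gweight x : R := expR (2 * primitive a x).

Let La : lintegrable a := rint_lintegrable Ia.
Let tot : R := \int[mu]_t a t.

Lemma primitive_a_ge0 x : 0 <= primitive a x.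
Proof. exact: Rintegral_ge0. Qed.

Lemma gweight_ge0 x : 0 <= gweight x. Proof. exact: expR_ge0. Qed.
Lemma gweight_ge1 x : 1 <= gweight x.
Proof. by rewrite -expR0 ler_expR mulr_ge0// primitive_a_ge0. Qed.

Lemma gweight_le x : gweight x <= expR (2 * tot).
Proof. by rewrite ler_expR ler_wpM2l// primitive_le_total. Qed.

Lemma measurable_gweight : measurable_fun setT gweight.
Proof.
apply: measurableT_comp => //; apply: measurable_funM => //.
exact: primitive_measurable.
Qed.

(** For [q <= p] the tangent inequality [1 + (q - p) <= expR (q - p)], multiplied by [expR p],
    bounds the difference by [expR p * (p - q)]. The exponential is Lipschitz only below a bound,
    which the total integral of [a] provides for the weight. *)
Lemma expR_lip (p q M : R) : p <= M -> q <= M ->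
  `|expR p - expR q| <= expR M * `|p - q|.
Proof.
wlog qp : p q / q <= p => [H pM qM|].
  have [/H|/ltW/H] := leP q p; first exact.
  by rewrite distrC (distrC p); exact.
move=> pM qM.
rewrite ger0_norm ?subr_ge0 ?ler_expR// ger0_norm ?subr_ge0//.
apply: (@le_trans _ _ (expR p * (p - q))); last first.
  by rewrite ler_wpM2r ?subr_ge0// ler_expR.
have := expR_ge1Dx (q - p); have := expR_gt0 p.
rewrite -[expR q](_ : expR p * expR (q - p) = _); last by rewrite -expRD addrC subrK.
by nra.
Qed.

Lemma rAC_gweight s t : rAC s t gweight.
Proof.
have cK : rAC s t (primitive a) by exact: primitive_rAC.
apply: (@rAC_dom _ _ _ (primitive a) (primitive a) _ (2 * expR (2 * tot))) => //.
move=> x y _ _ _; rewrite /gweight.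
apply: (le_trans (@expR_lip _ _ (2 * tot) _ _)).
- by rewrite ler_wpM2l// primitive_le_total.
- by rewrite ler_wpM2l// primitive_le_total.
rewrite -mulrBr normrM ger0_norm//.
have := expR_ge0 (2 * tot); have := normr_ge0 (primitive a y - primitive a x).
by nra.
Qed.

(** Almost everywhere the weight has derivative [2 * a * gweight], so half the weight minus the
    primitive has derivative zero and, being absolutely continuous, keeps its value at 0. There the
    primitive vanishes because [a] does on the left. *)
Lemma primitive_gweight x : primitive (fun t => a t * gweight t) x <= gweight x / 2.
Proof.
have Iag : rint setT (fun t => a t * gweight t).
  apply: (rintMb _ Ia measurable_gweight (M := expR (2 * tot))) => // t _.
  by rewrite ger0_norm ?gweight_ge0// gweight_le.
have Lag := rint_lintegrable Iag.
have neg t : t <= 0 -> primitive (fun t => a t * gweight t) t <= gweight t / 2.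
  move=> t0; rewrite primitive_eq0; first by rewrite divr_ge0// gweight_ge0.
  by move=> r rt; rewrite a_neg ?mul0r// (le_trans rt).
have [/neg//|/ltW x0] := leP x 0.
have : gweight x / 2 - primitive (fun t => a t * gweight t) x =
       gweight 0 / 2 - primitive (fun t => a t * gweight t) 0.
  apply: (@rAC_const _ 0 x (fun x => gweight x / 2 - primitive (fun t => a t * gweight t) x)) => //.
    apply: rACB; last exact: primitive_rAC.
    under eq_fun do rewrite mulrC; apply: rACZ; exact: rAC_gweight.
  have := ae_and (primitive_derive La) (primitive_derive Lag).
  apply: ae_mono => t [d1 d2] _.
  have d3 : is_derive t 1 gweight (2 * a t * gweight t).
    have d4 : is_derive t 1 (fun x => 2 * primitive a x) (2 * a t).
      by apply: (is_derive_eq (rderM (rder_cst _ _) d1)); rewrite mul0r add0r.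
    apply: (is_derive_eq (is_derive1_comp (is_derive_expR _) d4)).
    by rewrite mulrC.
  apply: (is_derive_eq (rderB (rderM d3 (rder_cst _ _)) d2)).
  by rewrite mulr0 addr0; field.
move=> E; rewrite -subr_ge0 E subr_ge0; exact: neg.
Qed.

End Gronwall.

(** * Picard iteration for real linear systems with integrable coefficients *)

Section LinearODE.
Context {R : realType} (I : finType).
Local Notation mu := (@lebesgue_measure R).
Variables (B : I -> I -> R -> R) (y0 : I -> R).
Hypotheses (IB : forall i j, rint setT (B i j))
  (B_neg : forall i j (x : R), x <= 0 -> B i j x = 0).

Let a (x : R) : R := \sum_i \sum_j `|B i j x|.
Let E := gweight a.
Let c : R := \sum_i `|y0 i|.

Let a_ge0 x : 0 <= a x.
Proof. by apply: sumr_ge0 => i _; apply: sumr_ge0. Qed.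

Let a_neg x : x <= 0 -> a x = 0.
Proof. by move=> x0; apply: big1 => i _; apply: big1 => j _; rewrite B_neg// normr0. Qed.

Let Ia : rint setT a.
Proof.
apply: rint_sum => // i; apply: rint_sum => // j.
exact: rint_norm.
Qed.

Let c_ge0 : 0 <= c. Proof. exact: sumr_ge0. Qed.

Let app (w : I -> R -> R) i x : R := \sum_j B i j x * w j x.

Let app_int (w : I -> R -> R) (M : R) i : (forall j, measurable_fun setT (w j)) ->
  (forall j x, `|w j x| <= M) -> rint setT (app w i).
Proof. by move=> mw wM; apply: rint_sum => // j; apply: (rintMb _ _ _ (M := M)). Qed.

Let app_le (w : I -> R -> R) (b : R -> R) i x : (forall j, `|w j x| <= b x) ->
  `|app w i x| <= a x * b x.
Proof.
move=> wb; rewrite (le_trans (ler_norm_sum _ _ _))//.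
apply: (@le_trans _ _ (\sum_j `|B i j x| * b x)).
  by apply: ler_sum => j _; rewrite normrM ler_wpM2l.
rewrite -mulr_suml ler_wpM2r//; first exact: (le_trans _ (wb i)).
rewrite /a [leRHS](bigD1 i)//= lerDl.
by apply: sumr_ge0 => k _; exact: sumr_ge0.
Qed.

(** These are the increments of the iteration, not the iterates: the integral operator applied [k]
    times to the constant [y0]. The iterates are the partial sums [W]. *)
Fixpoint picard (k : nat) : I -> R -> R :=
  if k is k'.+1 then fun i => primitive (app (picard k') i) else fun i _ => y0 i.

Let Emax : R := expR (2 * \int[mu]_t a t).

Let E_ge0 x : 0 <= E x. Proof. exact: gweight_ge0. Qed.
Let E_le x : E x <= Emax. Proof. exact: gweight_le. Qed.

(** By [primitive_gweight] each integration halves the weighted bound; the induction starts because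
    the weight is at least 1. Measurability travels along, being required to integrate the next
    increment. *)
Let picardP k : (forall i, measurable_fun setT (picard k i)) /\
  forall i x, `|picard k i x| <= c * 2^-1 ^+ k * E x.
Proof.
elim: k => [|k [mk bk]].
  split => [i|i x] /=; first exact: measurable_cst.
  rewrite expr0 mulr1 (@le_trans _ _ c)//.
    by rewrite /c (bigD1 i)//= lerDl sumr_ge0.
  by rewrite ler_peMr// gweight_ge1.
have IA i : rint setT (app (picard k) i).
  apply: (app_int (M := c * 2^-1 ^+ k * Emax)) => [//|j x].
  rewrite (le_trans (bk j x))// ler_wpM2l// mulr_ge0// exprn_ge0//.
have Iag : rint setT (fun t => a t * E t).
  apply: (rintMb _ Ia _ (M := Emax)) => //; first exact: measurable_gweight.
  by move=> t _; rewrite ger0_norm.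
split => [i|i x] /=; first by apply: primitive_measurable; exact: rint_lintegrable.
apply: (@le_trans _ _ (primitive (fun t => c * 2^-1 ^+ k * (a t * E t)) x)).
  apply: normr_primitive_le.
  - exact: rint_lintegrable.
  - exact/rint_lintegrable/rintZ.
  - move=> t; rewrite mulrCA; apply: (@app_le _ (fun t => c * 2^-1 ^+ k * E t)) => j.
    exact: bk.
rewrite /primitive RintegralZl//; last exact: rint_lintegrable.
rewrite -/(primitive _ _) exprS.
have := @primitive_gweight _ a a_ge0 a_neg Ia x; rewrite -/E => H.
have ck : 0 <= c * 2^-1 ^+ k by rewrite mulr_ge0// exprn_ge0.
rewrite (le_trans (ler_wpM2l ck H))//.
rewrite le_eqVlt; apply/orP; left; apply/eqP; ring.
Qed.

Let W k i x : R := series (fun l => picard l i x) k.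

Let W_measurable k i : measurable_fun setT (W k i).
Proof.
rewrite /W/= /series/=; apply: measurable_sum => l.
exact: (picardP l).1.
Qed.

(** The final 2 is the sum of the geometric series of ratio 1/2. The bound is uniform in [k] and
    [x], hence provides the majorant for dominated convergence. *)
Let W_bound k i x : `|W k i x| <= c * Emax * 2.
Proof.
rewrite /W /series/= (le_trans (ler_norm_sum _ _ _))//.
have half : `|2^-1 : R| < 1 by rewrite ger0_norm// invf_lt1// ltr1n.
apply: (@le_trans _ _ (series (geometric (c * Emax) 2^-1) k)).
  apply: ler_sum => l _ /=; rewrite (le_trans ((picardP l).2 i x))//.
  by rewrite mulrAC ler_wpM2r ?exprn_ge0// ler_wpM2l.
rewrite (le_trans (geometric_le_lim _ _ _ half))//.
  by rewrite mulr_ge0// expR_ge0.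
have -> : 1 - 2^-1 = 2^-1 :> R by lra.
by rewrite invrK.
Qed.

Let W_cvg i x : cvgn (fun k => W k i x).
Proof.
apply: normed_cvg.
apply: (@series_le_cvg _ _ (geometric (c * Emax) 2^-1)) => [n|n|n|] /=.
- by [].
- by rewrite mulr_ge0// ?exprn_ge0// mulr_ge0// expR_ge0.
- rewrite (le_trans ((picardP n).2 i x))//.
  by rewrite mulrAC ler_wpM2r ?exprn_ge0// ler_wpM2l.
- by apply: is_cvg_geometric_series; rewrite ger0_norm// invf_lt1// ltr1n.
Qed.

Let y i x : R := limn (fun k => W k i x).

Let y_measurable i : measurable_fun setT (y i).
Proof.
apply: (@measurable_fun_cvg _ _ _ _ (fun k => W k i)) => // x _; exact: W_cvg.
Qed.

Let y_bound i x : `|y i x| <= c * Emax * 2.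
Proof.
have b k : - (c * Emax * 2) <= W k i x <= c * Emax * 2 by rewrite -ler_norml W_bound.
rewrite ler_norml; apply/andP; split.
  by apply: limr_ge; [exact: W_cvg|apply: nearW => k; case/andP: (b k)].
by apply: limr_le; [exact: W_cvg|apply: nearW => k; case/andP: (b k)].
Qed.

(** [series] stops before its index: [W 0] is zero and [W 1] is [y0], which is the base case. *)
Let W_rec k i x : W k.+1 i x = y0 i + primitive (app (W k) i) x.
Proof.
elim: k => [|k IH].
  rewrite /W /series/= big_nat1 primitive_eq0 ?addr0// => t _.
  by rewrite /app big1// => j _; rewrite big_nil mulr0.
have -> : W k.+2 i x = W k.+1 i x + picard k.+1 i x by rewrite /W /series/= big_nat_recr.
rewrite IH -addrA; congr (_ + _); rewrite /= -primitiveD.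
- congr (primitive _ x); apply/funext => t; rewrite -big_split/=.
  by apply: eq_bigr => j _; rewrite -mulrDr /W /series/= big_nat_recr.
- by apply: rint_lintegrable; apply: (app_int (M := c * Emax * 2)).
- apply: rint_lintegrable; apply: (app_int (M := c * 2^-1 ^+ k * Emax)) => [j|j t].
    exact: (picardP k).1.
  rewrite (le_trans ((picardP k).2 j t))// ler_wpM2l// mulr_ge0// exprn_ge0//.
Qed.

(** Limit of [W_rec]: the left side converges by the geometric bound, the right side by dominated
    convergence with majorant [a t * M], and limits are unique. *)
Let y_eq i x : y i x = y0 i + primitive (app y i) x.
Proof.
pose M := c * Emax * 2.
have IW k : rint setT (app (W k) i) by apply: (app_int (M := M)).
have Iy : rint setT (app y i) by apply: (app_int (M := M)).
have IaM : rint setT (fun t => a t * M).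
  by under eq_fun do rewrite mulrC; exact: rintZ.
have mD : measurable (`]-oo, x] : set R) by exact: measurable_itv.
have H : (fun k => \int[mu]_(t in `]-oo, x]) (app (W k) i t)%:E)%E @ \oo -->
         (\int[mu]_(t in `]-oo, x]) (app y i t)%:E)%E.
  have [] := @dominated_convergence _ _ _ mu _ mD (fun k t => (app (W k) i t)%:E)
    (fun t => (app y i t)%:E) (fun t => (a t * M)%:E).
  - by move=> k; exact: (measurable_int mu (rint_lintegrable (IW k) x)).
  - exact: (measurable_int mu (rint_lintegrable Iy x)).
  - apply: aeW => t _; apply: cvg_EFin; first exact: nearW.
    rewrite /app; elim: (index_enum I) => [|j s IH].
      rewrite big_nil (_ : _ \o _ = fun=> 0); first exact: cvg_cst.
      by apply/funext => k /=; rewrite big_nil.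
    rewrite big_cons (_ : _ \o _ = fun k => B i j t * W k j t +
        \sum_(j <- s) B i j t * W k j t); last first.
      by apply/funext => k /=; rewrite big_cons.
    apply: cvgD => //; apply: cvgM; [exact: cvg_cst|exact: W_cvg].
  - exact: (rint_lintegrable IaM x).
  - apply: aeW => t k _; rewrite lee_fin.
    by apply: (app_le (b := fun=> M)) => j; exact: W_bound.
  - by [].
have Fy : (\int[mu]_(t in `]-oo, x]) (app y i t)%:E)%E = (primitive (app y i) x)%:E.
  rewrite /primitive /Rintegral fineK//; apply: integrable_fin_num => //.
  exact: (rint_lintegrable Iy x).
rewrite Fy in H; move/fine_cvgP : H => [_ H].
have H1 : (fun k => W k.+1 i x) @ \oo --> y0 i + primitive (app y i) x.
  under eq_fun do rewrite W_rec.
  by apply: cvgD; [exact: cvg_cst|exact: H].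
have H2 : (fun k => W k.+1 i x) @ \oo --> y i x.
  rewrite (cvg_shiftS (fun k => W k i x)); exact: W_cvg.
exact: (cvg_unique (@Rhausdorff R) H2 H1).
Qed.

Lemma linear_ode_exists : exists z : I -> R -> R,
  [/\ forall i, z i 0 = y0 i, forall i (s t : R), rAC s t (z i) &
      {ae mu, forall (x : R) (i : I), is_derive x 1 (z i) (\sum_j B i j x * z j x)}].
Proof.
have L i : lintegrable (app y i).
  by apply: rint_lintegrable; apply: (app_int (M := c * Emax * 2)).
exists y; split.
- move=> i; rewrite y_eq primitive_eq0 ?addr0// => t t0.
  by rewrite /app big1// => j _; rewrite B_neg// mul0r.
- move=> i s t; rewrite (_ : y i = fun x => y0 i + primitive (app y i) x); last first.
    by apply/funext => x; exact: y_eq.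
  by apply: rACD; [exact: rAC_cst|exact: primitive_rAC].
- apply: ae_fin => i; have := primitive_derive (L i); apply: ae_mono => x d.
  rewrite (_ : y i = fun x => y0 i + primitive (app y i) x); last first.
    by apply/funext => t; exact: y_eq.
  by apply: (is_derive_eq (rderD (rder_cst _ _) d)); rewrite add0r.
Qed.

End LinearODE.

(** * Complex functions through their real and imaginary parts *)

Section ComplexCalculus.
Context {R : realType}.
Local Notation C := (R[i]).
Local Notation mu := (@lebesgue_measure R).
Local Notation Re := complex.Re.
Local Notation Im := complex.Im.
Implicit Types (h k : R -> C) (a b x : R).

Lemma cReD (x y : C) : Re (x + y) = Re x + Re y. Proof. by case: x; case: y. Qed.
Lemma cImD (x y : C) : Im (x + y) = Im x + Im y. Proof. by case: x; case: y. Qed.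
Lemma cReM (x y : C) : Re (x * y) = Re x * Re y - Im x * Im y.
Proof. by case: x; case: y. Qed.
Lemma cImM (x y : C) : Im (x * y) = Re x * Im y + Im x * Re y.
Proof. by case: x; case: y. Qed.
Lemma cReJ (x : C) : Re (conjc x) = Re x. Proof. by case: x. Qed.
Lemma cImJ (x : C) : Im (conjc x) = - Im x. Proof. by case: x. Qed.
Lemma ceqP (x y : C) : Re x = Re y -> Im x = Im y -> x = y.
Proof. by case: x => a b; case: y => c d /= -> ->. Qed.
Lemma cRe_sum (I : Type) (s : seq I) (F : I -> C) :
  Re (\sum_(i <- s) F i) = \sum_(i <- s) Re (F i).
Proof. by elim/big_rec2: _ => // i x y _ <-; rewrite cReD. Qed.
Lemma cIm_sum (I : Type) (s : seq I) (F : I -> C) :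
  Im (\sum_(i <- s) F i) = \sum_(i <- s) Im (F i).
Proof. by elim/big_rec2: _ => // i x y _ <-; rewrite cImD. Qed.

Definition cAC a b h := rAC a b (fun x => Re (h x)) /\ rAC a b (fun x => Im (h x)).
Definition cder h x (d : C) :=
  is_derive x 1 (fun t => Re (h t)) (Re d) /\ is_derive x 1 (fun t => Im (h t)) (Im d).

Lemma cAC_cst a b (c : C) : cAC a b (fun=> c).
Proof. by split; exact: rAC_cst. Qed.

Lemma cACD a b h k : cAC a b h -> cAC a b k -> cAC a b (fun x => h x + k x).
Proof.
move=> [h1 h2] [k1 k2]; split.
  by under eq_fun do rewrite cReD; exact: (rACD h1 k1).
by under eq_fun do rewrite cImD; exact: (rACD h2 k2).
Qed.

Lemma cACM a b h k : cAC a b h -> cAC a b k -> cAC a b (fun x => h x * k x).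
Proof.
move=> [h1 h2] [k1 k2]; split.
  by under eq_fun do rewrite cReM; exact: (rACB (rACM h1 k1) (rACM h2 k2)).
by under eq_fun do rewrite cImM; exact: (rACD (rACM h1 k2) (rACM h2 k1)).
Qed.

Lemma cACJ a b h : cAC a b h -> cAC a b (fun x => conjc (h x)).
Proof.
move=> [h1 h2]; split; first by under eq_fun do rewrite cReJ.
by under eq_fun do rewrite cImJ; exact: (rACN h2).
Qed.

Lemma cAC_sum a b (I : Type) (s : seq I) (F : I -> R -> C) :
  (forall i, cAC a b (F i)) -> cAC a b (fun x => \sum_(i <- s) F i x).
Proof.
move=> cF; elim: s => [|i s IH].
  by under eq_fun do rewrite big_nil; exact: cAC_cst.
by under eq_fun do rewrite big_cons; exact: (cACD (cF i) IH).
Qed.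

Lemma cder_cst x (c : C) : cder (fun=> c) x 0.
Proof. by split; exact: rder_cst. Qed.

Lemma cderD h k x dh dk : cder h x dh -> cder k x dk ->
  cder (fun t => h t + k t) x (dh + dk).
Proof.
move=> [h1 h2] [k1 k2]; split.
  by rewrite cReD; under eq_fun do rewrite cReD; exact: (rderD h1 k1).
by rewrite cImD; under eq_fun do rewrite cImD; exact: (rderD h2 k2).
Qed.

Lemma cderM h k x dh dk : cder h x dh -> cder k x dk ->
  cder (fun t => h t * k t) x (dh * k x + h x * dk).
Proof.
move=> [h1 h2] [k1 k2]; split.
  rewrite cReD !cReM; under eq_fun do rewrite cReM.
  by apply: (is_derive_eq (rderB (rderM h1 k1) (rderM h2 k2))); ring.
rewrite cImD !cImM; under eq_fun do rewrite cImM.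
by apply: (is_derive_eq (rderD (rderM h1 k2) (rderM h2 k1))); ring.
Qed.

Lemma cderJ h x d : cder h x d -> cder (fun t => conjc (h t)) x (conjc d).
Proof.
move=> [h1 h2]; split; first by rewrite cReJ; under eq_fun do rewrite cReJ.
by rewrite cImJ; under eq_fun do rewrite cImJ; exact: (rderN h2).
Qed.

Lemma cder_sum x (I : Type) (s : seq I) (F : I -> R -> C) (dF : I -> C) :
  (forall i, cder (F i) x (dF i)) ->
  cder (fun t => \sum_(i <- s) F i t) x (\sum_(i <- s) dF i).
Proof.
move=> cF; elim: s => [|i s IH].
  by rewrite big_nil; under eq_fun do rewrite big_nil; exact: cder_cst.
by rewrite big_cons; under eq_fun do rewrite big_cons; exact: (cderD (cF i) IH).
Qed.

Lemma cmeas_cst D (c : C) : cmeasurable D (fun=> c).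
Proof. by split; exact: measurable_cst. Qed.

Lemma cmeasD D h k : cmeasurable D h -> cmeasurable D k ->
  cmeasurable D (fun x => h x + k x).
Proof.
move=> [h1 h2] [k1 k2]; split.
  by under eq_fun do rewrite cReD; exact: (measurable_funD h1 k1).
by under eq_fun do rewrite cImD; exact: (measurable_funD h2 k2).
Qed.

Lemma cmeasM D h k : cmeasurable D h -> cmeasurable D k ->
  cmeasurable D (fun x => h x * k x).
Proof.
move=> [h1 h2] [k1 k2]; split.
  by under eq_fun do rewrite cReM;
    exact: (measurable_funB (measurable_funM h1 k1) (measurable_funM h2 k2)).
by under eq_fun do rewrite cImM;
  exact: (measurable_funD (measurable_funM h1 k2) (measurable_funM h2 k1)).
Qed.

Lemma cmeasJ D h : cmeasurable D h -> cmeasurable D (fun x => conjc (h x)).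
Proof.
move=> [h1 h2]; split; first by under eq_fun do rewrite cReJ.
by under eq_fun do rewrite cImJ; exact: (measurable_funN h2).
Qed.

Lemma cmeas_sum D (I : Type) (s : seq I) (F : I -> R -> C) :
  (forall i, cmeasurable D (F i)) -> cmeasurable D (fun x => \sum_(i <- s) F i x).
Proof.
move=> cF; elim: s => [|i s IH].
  by under eq_fun do rewrite big_nil; exact: cmeas_cst.
by under eq_fun do rewrite big_cons; exact: (cmeasD (cF i) IH).
Qed.

Lemma cmeasS D E h : measurable D -> E `<=` D -> cmeasurable D h -> cmeasurable E h.
Proof. by move=> mD ED [h1 h2]; split; exact: (measurable_funS mD ED). Qed.

End ComplexCalculus.

(** * Matrix functions and positive semidefinite matrices *)

Section MatrixCalculus.
Context {R : realType}.
Local Notation C := (R[i]).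
Local Notation mu := (@lebesgue_measure R).
Local Notation Re := complex.Re.
Local Notation Im := complex.Im.

Lemma adjmxE m p (A : 'M[C]_(m, p)) i j : adjmx A i j = conjc (A j i).
Proof. by rewrite !mxE. Qed.

Lemma adjmxD m p (A B : 'M[C]_(m, p)) : adjmx (A + B) = adjmx A + adjmx B.
Proof. by apply/matrixP => i j; rewrite !mxE rmorphD. Qed.

Lemma adjmxZ m p (c : C) (A : 'M[C]_(m, p)) : adjmx (c *: A) = conjc c *: adjmx A.
Proof. by apply/matrixP => i j; rewrite !mxE rmorphM. Qed.

Lemma adjmxM m p q (A : 'M[C]_(m, p)) (B : 'M[C]_(p, q)) :
  adjmx (A *m B) = adjmx B *m adjmx A.
Proof.
apply/matrixP => i j; rewrite !mxE rmorph_sum.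
by apply: eq_bigr => k _; rewrite !mxE rmorphM mulrC.
Qed.

Lemma adjmx1 m : adjmx (1%:M : 'M[C]_m) = 1%:M.
Proof. by apply/matrixP => i j; rewrite !mxE eq_sym rmorphMn rmorph1. Qed.

Lemma adjmx_Jmx n : adjmx (Jmx n : 'M[C]_(n + n)) = - Jmx n.
Proof.
rewrite /adjmx /Jmx map_block_mx tr_block_mx opp_block_mx.
rewrite !map_mx0 !trmx0 map_mxN map_mx1 linearN/= trmx1 oppr0.
by rewrite opprK.
Qed.

Lemma Jmx_sq n : Jmx n *m Jmx n = - 1%:M :> 'M[C]_(n + n).
Proof.
rewrite /Jmx mulmx_block !(mulmx0, mul0mx, mulmx1, mul1mx, add0r, addr0).
by rewrite [in RHS](scalar_mx_block n n) opp_block_mx !oppr0.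
Qed.

Lemma normsq_col m (w : 'cV[C]_m) :
  Re ((adjmx w *m w) 0 0) = \sum_i (Re (w i 0) ^+ 2 + Im (w i 0) ^+ 2).
Proof.
rewrite mxE cRe_sum; apply: eq_bigr => i _.
by rewrite adjmxE cReM cReJ cImJ; ring.
Qed.

Lemma normsq_col_eq0 m (w : 'cV[C]_m) : Re ((adjmx w *m w) 0 0) = 0 -> w = 0.
Proof.
rewrite normsq_col => /psumr_eq0P H.
have {}H i : Re (w i 0) ^+ 2 + Im (w i 0) ^+ 2 = 0.
  by apply: H => // j _; rewrite addr_ge0// sqr_ge0.
apply/matrixP => i j; rewrite ord1 !mxE; have := H i.
by move=> h; apply: ceqP => /=; nra.
Qed.

Definition sesq m (A : 'M[C]_m) (v w : 'cV[C]_m) : C := (adjmx v *m A *m w) 0 0.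

Lemma sesqDl m (A : 'M[C]_m) v w u : sesq A (v + w) u = sesq A v u + sesq A w u.
Proof. by rewrite /sesq adjmxD !mulmxDl [LHS]mxE. Qed.

Lemma sesqDr m (A : 'M[C]_m) v w u : sesq A u (v + w) = sesq A u v + sesq A u w.
Proof. by rewrite /sesq !mulmxDr [LHS]mxE. Qed.

Lemma sesqZl m (A : 'M[C]_m) (c : C) v w : sesq A (c *: v) w = conjc c * sesq A v w.
Proof. by rewrite /sesq adjmxZ -!scalemxAl [LHS]mxE. Qed.

Lemma sesqZr m (A : 'M[C]_m) (c : C) v w : sesq A v (c *: w) = c * sesq A v w.
Proof. by rewrite /sesq -!scalemxAr [LHS]mxE. Qed.

Lemma sesq_delta m (A : 'M[C]_m) i j : sesq A (delta_mx i 0) (delta_mx j 0) = A i j.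
Proof.
rewrite /sesq (_ : adjmx _ = delta_mx 0 i); last first.
  by apply/matrixP => a b; rewrite !mxE andbC rmorph_nat.
by rewrite -rowE -colE !mxE.
Qed.

Lemma psdmx_sesq m (A : 'M[C]_m) v : psdmx A -> Im (sesq A v v) = 0 /\ 0 <= Re (sesq A v v).
Proof. by move=> /(_ v); rewrite lecE => /andP[/eqP]. Qed.

(** Nonnegativity in the order of the complex numbers already says that the quadratic form is real.
    Polarisation with [v + w] and [v + 'i *: w] then gives the symmetry of the sesquilinear form. *)
Lemma psdmx_herm m (A : 'M[C]_m) : psdmx A -> adjmx A = A.
Proof.
move=> pA.
have real v : Im (sesq A v v) = 0 by have [] := psdmx_sesq v pA.
have sym v w : conjc (sesq A v w) = sesq A w v.
  have := real (v + w); rewrite sesqDl !sesqDr !cImD !real => h1.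
  have := real (v + 'i *: w); rewrite sesqDl !sesqDr !sesqZl !sesqZr.
  move: h1; have := real w; have := real v.
  case: (sesq A v v) (sesq A v w) (sesq A w v) (sesq A w w)
    => a a' [b b'] [c c'] [d d'] /= h1 h2 h3 h4.
  by apply: ceqP => /=; lra.
by apply/matrixP => i j; rewrite adjmxE -!sesq_delta sym.
Qed.

(** At [s = b / (c + 1)] the quadratic equals [- s ^+ 2 * (c + 2)], so [s], and with it [b], is
    zero. *)
Lemma quad_ge0_lin0 (b c : R) : 0 <= b -> 0 <= c ->
  (forall s, 0 <= s ^+ 2 * c - 2 * s * b) -> b = 0.
Proof.
move=> b0 c0 H; have c1 : 0 < c + 1 by lra.
have E : (c + 1) * (b / (c + 1)) = b by rewrite mulrC divfK ?gt_eqF.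
by have := H (b / (c + 1)); move: (b / _) E => s E; nra.
Qed.

(** Perturb [v] in the direction [w = A *m v]: the form at [v - s w] is quadratic in [s] with linear
    coefficient -2|w|^2 and no constant term, so nonnegativity for every [s] forces [w = 0]. *)
Lemma psdmx_null m (A : 'M[C]_m) (v : 'cV[C]_m) : psdmx A ->
  Re ((adjmx v *m A *m v) 0 0) = 0 -> A *m v = 0.
Proof.
rewrite -/(sesq A v v) => pA v0; pose w := A *m v.
have wA : adjmx w = adjmx v *m A by rewrite adjmxM psdmx_herm.
apply: normsq_col_eq0; set b := Re _.
have b0 : 0 <= b.
  by rewrite /b normsq_col; apply: sumr_ge0 => i _; rewrite addr_ge0// sqr_ge0.
have [_ c0] := psdmx_sesq w pA.
have vw : Re (sesq A v w) = b by rewrite /sesq -wA.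
have wv : Re (sesq A w v) = b by rewrite /sesq -mulmxA.
have H (s : R) : 0 <= s ^+ 2 * Re (sesq A w w) - 2 * s * b.
  have [_] := psdmx_sesq (v + (- s)%:C%C *: w) pA.
  rewrite sesqDl !sesqDr !sesqZl !sesqZr !cReD v0.
  rewrite !(cReM, cReJ, cImJ, cImM)/= vw wv.
  move: (Re (sesq A w w)) => c h.
  by rewrite (le_trans h)// le_eqVlt; apply/orP; left; apply/eqP; ring.
exact: quad_ge0_lin0 b0 c0 H.
Qed.

Lemma mAC_mulmx m p q a b (F : R -> 'M[C]_(m, p)) (G : R -> 'M[C]_(p, q)) :
  mAC a b F -> mAC a b G -> mAC a b (fun x => F x *m G x).
Proof.
move=> cF cG i j; rewrite /=.
have : cAC a b (fun x => \sum_k F x i k * G x k j).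
  by apply: cAC_sum => k; exact: (cACM (cF i k) (cG k j)).
by move=> [h1 h2]; split; [move: h1|move: h2]; apply: rAC_eq => x _; rewrite mxE.
Qed.

Lemma mAC_cst m p a b (A : 'M[C]_(m, p)) : mAC a b (fun=> A).
Proof. by move=> i j; exact: (cAC_cst a b (A i j)). Qed.

Lemma mAC_adj m p a b (F : R -> 'M[C]_(m, p)) : mAC a b F -> mAC a b (fun x => adjmx (F x)).
Proof.
move=> cF i j; have [h1 h2] := cACJ (cF j i).
by split; [move: h1|move: h2]; apply: rAC_eq => x _; rewrite adjmxE.
Qed.

Lemma mACD m p a b (F G : R -> 'M[C]_(m, p)) :
  mAC a b F -> mAC a b G -> mAC a b (fun x => F x + G x).
Proof.
move=> cF cG i j; have [h1 h2] := cACD (cF i j) (cG i j).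
by split; [move: h1|move: h2]; apply: rAC_eq => x _; rewrite mxE.
Qed.

Lemma mAC_eq m p a b (F G : R -> 'M[C]_(m, p)) :
  (forall x, a <= x <= b -> F x = G x) -> mAC a b F -> mAC a b G.
Proof.
move=> FG cF i j; have [h1 h2] := cF i j.
by split; [move: h1|move: h2]; apply: rAC_eq => x /FG ->.
Qed.

Lemma mACS m p a b a' b' (F : R -> 'M[C]_(m, p)) : a <= a' -> b' <= b ->
  mAC a b F -> mAC a' b' F.
Proof. by move=> ? ? cF i j; have [h1 h2] := cF i j; split; exact: (rACS (a := a) (b := b)). Qed.

Lemma mAC_glue m p a b c (F : R -> 'M[C]_(m, p)) : a <= b -> b <= c ->
  mAC a b F -> mAC b c F -> mAC a c F.
Proof.
move=> ab bc cF cG i j; have [h1 h2] := cF i j; have [k1 k2] := cG i j.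
by split; exact: (rAC_glue (b := b)).
Qed.

Lemma mderiv_mulmx m p q (F : R -> 'M[C]_(m, p)) (G : R -> 'M[C]_(p, q)) x dF dG :
  mderiv F x dF -> mderiv G x dG ->
  mderiv (fun t => F t *m G t) x (dF *m G x + F x *m dG).
Proof.
move=> cF cG i j.
have : cder (fun t => \sum_k F t i k * G t k j) x (\sum_k (dF i k * G x k j + F x i k * dG k j)).
  by apply: cder_sum => k; exact: (cderM (cF i k) (cG k j)).
by rewrite big_split/= !mxE => -[h1 h2]; split; under eq_fun do rewrite mxE.
Qed.

Lemma mderiv_cst m p (A : 'M[C]_(m, p)) x : mderiv (fun=> A) x 0.
Proof. by move=> i j; rewrite mxE; exact: (cder_cst x (A i j)). Qed.

Lemma mderiv_adj m p (F : R -> 'M[C]_(m, p)) x d : mderiv F x d ->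
  mderiv (fun t => adjmx (F t)) x (adjmx d).
Proof.
move=> cF i j; have [h1 h2] := cderJ (cF j i); rewrite adjmxE.
by split; under eq_fun do rewrite adjmxE.
Qed.

Lemma mderivD m p (F G : R -> 'M[C]_(m, p)) x dF dG : mderiv F x dF -> mderiv G x dG ->
  mderiv (fun t => F t + G t) x (dF + dG).
Proof.
move=> cF cG i j; have [h1 h2] := cderD (cF i j) (cG i j); rewrite mxE.
by split; under eq_fun do rewrite mxE.
Qed.

Lemma mderiv_near m p (F G : R -> 'M[C]_(m, p)) (c d : R) x dF : c < x < d ->
  (forall t, c < t < d -> F t = G t) -> mderiv F x dF -> mderiv G x dF.
Proof.
move=> /andP[cx xd] FG cF i j; have [h1 h2] := cF i j.
have E : \forall t \near x, F t = G t.
  near=> t; apply: FG; apply/andP; split; near: t.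
    exact: lt_nbhsr.
  exact: lt_nbhsl.
split; [apply: near_eq_is_derive h1|apply: near_eq_is_derive h2] => //.
  by apply: filterS E => t ->.
by apply: filterS E => t ->.
Unshelve. all: by end_near. Qed.

Lemma mAC_const m p a b (F : R -> 'M[C]_(m, p)) : a <= b -> mAC a b F ->
  {ae mu, forall x : R, a < x < b -> mderiv F x 0} -> F b = F a.
Proof.
move=> ab cF dF; apply/matrixP => i j; have [h1 h2] := cF i j.
apply: ceqP.
  apply: (rAC_const ab h1); move: dF; apply: ae_mono => x H; rewrite in_itv/= => /H /(_ i j)[].
  by rewrite mxE.
apply: (rAC_const ab h2); move: dF; apply: ae_mono => x H; rewrite in_itv/= => /H /(_ i j)[].
by rewrite mxE.
Qed.

End MatrixCalculus.

(** * The weighted space: norms, classes and restriction *)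

Section WeightedL2.
Context {R : realType}.
Local Notation C := (R[i]).
Local Notation mu := (@lebesgue_measure R).
Local Notation Re := complex.Re.
Local Notation Im := complex.Im.
Implicit Types (D E : set R).

Lemma rintU D E (f : R -> R) : measurable D -> measurable E ->
  rint D f -> rint E f -> rint (D `|` E) f.
Proof.
move=> mD mE ID IE.
have IE' : rint (E `\` D) f by apply: (rintS mE) => //; exact: measurableD.
have -> : D `|` E = D `|` (E `\` D) by rewrite setDE setUIr setUv setIT.
have mED : measurable (E `\` D) by exact: measurableD.
have mf : measurable_fun (D `|` (E `\` D)) f.
  by apply/measurable_funU => //; split; exact: rint_measurable.
apply/integrableP; split; first exact/measurable_EFinP.
rewrite ge0_integral_setU//.
- case/integrableP : ID => _ h1; case/integrableP : IE' => _ h2.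
  exact: lte_add_pinfty.
- by apply: measurableT_comp => //; exact/measurable_EFinP.
- by apply/disj_setPS; rewrite setDE setIC -setIA setICl setI0.
Qed.

Lemma rint_ae0 D (f : R -> R) : measurable D -> measurable_fun D f ->
  (\int[mu]_(x in D) `|f x|%:E = 0)%E <-> {ae mu, forall x, D x -> f x = 0}.
Proof.
move=> mD mf; have mf' : measurable_fun D (EFin \o f) by exact/measurable_EFinP.
have [h1 h2] := @ae_eq_integral_abs _ _ _ mu D mD _ mf'; split.
  by move/h1; apply: ae_mono => x H /H [].
by move=> h; apply: h2; move: h; apply: ae_mono => x H /H /= ->.
Qed.

Definition mmeas D m p (F : R -> 'M[C]_(m, p)) :=
  forall i j, cmeasurable D (fun x => F x i j).

Lemma mmeas_cst D m p (A : 'M[C]_(m, p)) : mmeas D (fun=> A).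
Proof. by move=> i j; exact: (cmeas_cst D (A i j)). Qed.

Lemma mmeas_mulmx D m p q (F : R -> 'M[C]_(m, p)) (G : R -> 'M[C]_(p, q)) :
  mmeas D F -> mmeas D G -> mmeas D (fun x => F x *m G x).
Proof.
move=> mF mG i j.
rewrite (_ : (fun x => _) = fun x => \sum_k F x i k * G x k j); last first.
  by apply/funext => x; rewrite mxE.
by apply: cmeas_sum => k; exact: (cmeasM (mF i k) (mG k j)).
Qed.

Lemma mmeas_adj D m p (F : R -> 'M[C]_(m, p)) : mmeas D F -> mmeas D (fun x => adjmx (F x)).
Proof.
move=> mF i j.
rewrite (_ : (fun x => _) = fun x => conjc (F x j i)); last first.
  by apply/funext => x; rewrite adjmxE.
exact: (cmeasJ (mF j i)).
Qed.

Lemma mmeasD D m p (F G : R -> 'M[C]_(m, p)) : mmeas D F -> mmeas D G ->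
  mmeas D (fun x => F x + G x).
Proof.
move=> mF mG i j.
rewrite (_ : (fun x => _) = fun x => F x i j + G x i j); last first.
  by apply/funext => x; rewrite mxE.
exact: (cmeasD (mF i j) (mG i j)).
Qed.

Lemma mmeasZ D m p (c : C) (F : R -> 'M[C]_(m, p)) : mmeas D F ->
  mmeas D (fun x => c *: F x).
Proof.
move=> mF; rewrite (_ : (fun x => _) = fun x => c%:M *m F x).
  by apply: mmeas_mulmx => //; exact: mmeas_cst.
by apply/funext => x; rewrite mul_scalar_mx.
Qed.

Lemma mmeasB D m p (F G : R -> 'M[C]_(m, p)) : mmeas D F -> mmeas D G ->
  mmeas D (fun x => F x - G x).
Proof.
move=> mF mG; rewrite (_ : (fun x => _) = fun x => F x + (-1) *: G x).
  by apply: mmeasD => //; exact: mmeasZ.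
by apply/funext => x; rewrite scaleN1r.
Qed.

Lemma mmeasS D E m p (F : R -> 'M[C]_(m, p)) : measurable D -> E `<=` D ->
  mmeas D F -> mmeas E F.
Proof. by move=> mD ED mF i j; exact: (cmeasS mD ED). Qed.

Lemma mmeas_eq D m p (F G : R -> 'M[C]_(m, p)) : (forall x, D x -> F x = G x) ->
  mmeas D F -> mmeas D G.
Proof.
move=> FG mF i j; have [h1 h2] := mF i j.
by split; [apply: eq_measurable_fun h1|apply: eq_measurable_fun h2] => x;
  rewrite inE => /FG ->.
Qed.

Lemma mmeas_col D m (f : R -> 'cV[C]_m) :
  (forall i, cmeasurable D (fun x => f x i 0)) <-> mmeas D f.
Proof. by split=> [mf i j|mf i]; [rewrite ord1|]; exact: mf. Qed.

Section Weight.
Variables (m : nat) (H : R -> 'M[C]_m) (D : set R).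
Hypotheses (mD : measurable D) (mH : mmeas D H)
  (pH : {ae mu, forall x : R, D x -> psdmx (H x)}).
Implicit Types f g : R -> 'cV[C]_m.

Lemma Hform_measurable f : mmeas D f -> measurable_fun D (fun x => Re (Hform H f f x)).
Proof.
move=> mf; have [] // : cmeasurable D (fun x => Hform H f f x).
apply: (mmeas_mulmx _ mf 0 0); apply: mmeas_mulmx => //; exact: mmeas_adj.
Qed.

(** The form is known to be nonnegative only a.e.; with the absolute value it is so everywhere, as
    monotonicity and additivity of the integral require. *)
Lemma Hnorm2_abs f : mmeas D f ->
  Hnorm2 D H f = (\int[mu]_(x in D) `|Re (Hform H f f x)|%:E)%E.
Proof.
move=> mf; have mh := Hform_measurable mf.
apply: ae_eq_integral => //.
- exact/measurable_EFinP.
- by apply/measurable_EFinP; exact: measurableT_comp.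
- move: pH; apply: ae_mono => x px Dx; congr EFin.
  by rewrite ger0_norm//; have [] := psdmx_sesq (f x) (px Dx).
Qed.

(** A nonnegative form with zero integral vanishes a.e., and [psdmx_null] upgrades this to
    [H x *m f x = 0]. Equality of classes thereby becomes an a.e. identity that can be substituted
    into the differential equation. *)
Lemma Hnull_ae f : mmeas D f ->
  Hnull D H f <-> {ae mu, forall x, D x -> H x *m f x = 0}.
Proof.
move=> mf; rewrite /Hnull Hnorm2_abs//.
have [h1 h2] := rint_ae0 mD (Hform_measurable mf); split.
  move/h1 => h; have := ae_and pH h; apply: ae_mono => x [px hx] Dx.
  by apply: psdmx_null; [exact: px|exact: hx].
move=> h; apply: h2; move: h; apply: ae_mono => x hx /hx E.
by rewrite /Hform -mulmxA E mulmx0 mxE.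
Qed.

Lemma Hequiv_ae f g : mmeas D f -> mmeas D g ->
  Hequiv D H f g <-> {ae mu, forall x, D x -> H x *m f x = H x *m g x}.
Proof.
move=> mf mg; rewrite /Hequiv Hnull_ae; last exact: mmeasB.
split; apply: ae_mono => x h /h; rewrite mulmxBr.
  by move/subr0_eq.
by move=> ->; rewrite subrr.
Qed.

Lemma Hnorm2_ae f g : mmeas D f -> mmeas D g ->
  {ae mu, forall x, D x -> H x *m f x = H x *m g x} -> Hnorm2 D H f = Hnorm2 D H g.
Proof.
move=> mf mg fg; apply: ae_eq_integral => //.
- by apply/measurable_EFinP; exact: Hform_measurable.
- by apply/measurable_EFinP; exact: Hform_measurable.
(* The form sees [f] only through [H x *m f x]: after the right factor is replaced, Hermitian
   symmetry moves [H x] to the left factor. *)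
- have := ae_and pH fg; apply: ae_mono => x [px h] Dx; congr ((Re _)%:E).
  have hH := psdmx_herm (px Dx); rewrite /Hform -[LHS]/((_ *m _) 0 0).
  rewrite -mulmxA (h Dx) mulmxA -{1}hH -adjmxM (h Dx) adjmxM hH.
  by [].
Qed.

Lemma Hnorm2_le E f : measurable E -> E `<=` D -> mmeas D f ->
  (Hnorm2 E H f <= Hnorm2 D H f)%E.
Proof.
move=> mE ED mf.
have mfE : mmeas E f by exact: mmeasS mf.
rewrite (Hnorm2_abs mf) [leLHS](_ : _ = (\int[mu]_(x in E) `|Re (Hform H f f x)|%:E)%E).
  apply: ge0_subset_integral => //.
  by apply/measurable_EFinP; apply: measurableT_comp => //; exact: Hform_measurable.
have mh := measurable_funS mD ED (Hform_measurable mf).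
apply: ae_eq_integral => //.
- exact/measurable_EFinP.
- by apply/measurable_EFinP; exact: measurableT_comp.
- move: pH; apply: ae_mono => x px Ex; congr EFin.
  by rewrite ger0_norm//; have [] := psdmx_sesq (f x) (px (ED _ Ex)).
Qed.

Lemma L2H_sub E f : measurable E -> E `<=` D -> L2H D H f -> L2H E H f.
Proof.
move=> mE ED [/mmeas_col mf nf]; split; first exact/mmeas_col/(mmeasS mD ED).
exact: le_lt_trans (Hnorm2_le mE ED mf) nf.
Qed.

Lemma L2H_ae f g : mmeas D g -> {ae mu, forall x, D x -> H x *m f x = H x *m g x} ->
  L2H D H f -> L2H D H g.
Proof.
move=> mg fg [/mmeas_col mf nf]; split; first exact/mmeas_col.
by rewrite -(Hnorm2_ae mf mg).
Qed.

End Weight.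

Lemma eq_Hnorm2 D m (H : R -> 'M[C]_m) f g : (forall x, D x -> f x = g x) ->
  Hnorm2 D H f = Hnorm2 D H g.
Proof.
by move=> fg; apply: eq_integral => x; rewrite inE => /fg E; rewrite /Hform E.
Qed.

Lemma eq_L2H D m (H : R -> 'M[C]_m) f g : (forall x, D x -> f x = g x) ->
  L2H D H f -> L2H D H g.
Proof.
move=> fg [/mmeas_col mf nf]; split; first exact/mmeas_col/(mmeas_eq fg).
by rewrite -(eq_Hnorm2 H fg).
Qed.

Lemma Hnorm2_split m (H : R -> 'M[C]_m) (L : R) f : 0 < L ->
  mmeas `]0, +oo[ H -> {ae mu, forall x : R, 0 < x -> psdmx (H x)} -> mmeas `]0, +oo[ f ->
  Hnorm2 `]0, +oo[ H f =
    (Hnorm2 [set` `]0, L[%R] H f + Hnorm2 [set` `]L, +oo[%R] H f)%E.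
Proof.
move=> L0 mH pH mf.
have pH' : {ae mu, forall x : R, (`]0, +oo[%classic : set R) x -> psdmx (H x)}.
  by move: pH; apply: ae_mono => x h; rewrite /= in_itv/= andbT.
have mD : measurable (`]0, +oo[%classic : set R) by exact: measurable_itv.
have s1 : `]0, L[%classic `<=` (`]0, +oo[%classic : set R).
  by move=> x /=; rewrite !in_itv/= => /andP[->].
have s2 : `]L, +oo[%classic `<=` (`]0, +oo[%classic : set R).
  by move=> x /=; rewrite !in_itv/= !andbT; exact: lt_trans.
have mh := Hform_measurable mH mf.
have ma : measurable_fun (`]0, +oo[ : set R) (fun x => `|Re (Hform H f f x)|%:E).
  by apply/measurable_EFinP; exact: measurableT_comp.
rewrite (Hnorm2_abs mD mH pH' mf).
rewrite (@Hnorm2_abs m H `]0, L[) //; last 3 first.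
- exact: mmeasS mH.
- by move: pH'; apply: ae_mono => x h /s1.
- exact: mmeasS mf.
rewrite (@Hnorm2_abs m H `]L, +oo[) //; last 3 first.
- exact: mmeasS mH.
- by move: pH'; apply: ae_mono => x h /s2.
- exact: mmeasS mf.
(* Adding the null point [L] to the first interval makes the two intervals cover the half-line
   exactly. *)
rewrite integral_itv_bndo_bndc; last exact: measurable_funS ma.
rewrite -ge0_integral_setU//.
- by rewrite -itv_bndbnd_setU// bnd_simp// ltW.
- by rewrite -itv_bndbnd_setU// bnd_simp// ltW.
- apply/disj_setPS => x /= []; rewrite !in_itv/= => /andP[_ xL] /andP[Lx _].
  by move: Lx; rewrite ltNge xL.
Qed.

End WeightedL2.

(** * Complex integrability and existence for complex linear systems *)

Section ComplexIntegrable.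
Context {R : realType}.
Local Notation C := (R[i]).
Local Notation mu := (@lebesgue_measure R).
Local Notation Re := complex.Re.
Local Notation Im := complex.Im.
Implicit Types (D E : set R) (h k : R -> C).

Definition cbounded D h := exists M : R, forall x, D x -> `|Re (h x)| <= M /\ `|Im (h x)| <= M.

Lemma cint_cst0 D : cintegrable D (fun=> 0 : C).
Proof. by split; exact: (rint0 D). Qed.

Lemma cintD D h k : measurable D -> cintegrable D h -> cintegrable D k ->
  cintegrable D (fun x => h x + k x).
Proof.
move=> mD [h1 h2] [k1 k2]; split.
  by under eq_fun do rewrite cReD; exact: (rintD mD h1 k1).
by under eq_fun do rewrite cImD; exact: (rintD mD h2 k2).
Qed.

Lemma cint_sum D (I : Type) (s : seq I) (F : I -> R -> C) : measurable D ->
  (forall i, cintegrable D (F i)) -> cintegrable D (fun x => \sum_(i <- s) F i x).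
Proof.
move=> mD cF; elim: s => [|i s IH].
  by under eq_fun do rewrite big_nil; exact: cint_cst0.
by under eq_fun do rewrite big_cons; exact: (cintD mD (cF i) IH).
Qed.

Lemma cintMb D h k : measurable D -> cintegrable D h -> cmeasurable D k ->
  cbounded D k -> cintegrable D (fun x => h x * k x).
Proof.
move=> mD [h1 h2] [k1 k2] [M kM].
have b1 x : D x -> `|Re (k x)| <= M by move=> /kM[].
have b2 x : D x -> `|Im (k x)| <= M by move=> /kM[].
split.
  under eq_fun do rewrite cReM.
  exact: (rintD mD (rintMb mD h1 k1 b1) (rintN mD (rintMb mD h2 k2 b2))).
under eq_fun do rewrite cImM.
exact: (rintD mD (rintMb mD h1 k2 b2) (rintMb mD h2 k1 b1)).
Qed.

Lemma cintZ D h (c : C) : measurable D -> cintegrable D h ->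
  cintegrable D (fun x => c * h x).
Proof.
move=> mD Ih; under eq_fun do rewrite mulrC; apply: (cintMb mD Ih); first exact: cmeas_cst.
by exists (`|Re c| + `|Im c|) => x _; rewrite lerDl lerDr.
Qed.

Lemma cint_measurable D h : cintegrable D h -> cmeasurable D h.
Proof. by move=> [h1 h2]; split; exact: rint_measurable. Qed.

Definition mint D m p (F : R -> 'M[C]_(m, p)) := forall i j, cintegrable D (fun x => F x i j).

Lemma mint_mulmxb D m p q (F : R -> 'M[C]_(m, p)) (G : R -> 'M[C]_(p, q)) : measurable D ->
  mint D F -> mmeas D G -> (forall i j, cbounded D (fun x => G x i j)) ->
  mint D (fun x => F x *m G x).
Proof.
move=> mD IF mG bG i j.
rewrite (_ : (fun x => _) = fun x => \sum_k F x i k * G x k j); last first.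
  by apply/funext => x; rewrite mxE.
by apply: cint_sum => // k; exact: cintMb.
Qed.

Lemma mint_mulmxl D m p q (A : 'M[C]_(m, p)) (G : R -> 'M[C]_(p, q)) : measurable D ->
  mint D G -> mint D (fun x => A *m G x).
Proof.
move=> mD IG i j.
rewrite (_ : (fun x => _) = fun x => \sum_k A i k * G x k j); last first.
  by apply/funext => x; rewrite mxE.
by apply: cint_sum => // k; exact: (cintZ (A i k) mD (IG k j)).
Qed.

Lemma cbounded_conj D h : cbounded D h -> cbounded D (fun x => conjc (h x)).
Proof. by move=> [M hM]; exists M => x /hM; rewrite cReJ cImJ normrN. Qed.

Lemma mAC_cbounded D m p a b (F : R -> 'M[C]_(m, p)) : mAC a b F ->
  (forall x, D x -> a <= x <= b) -> forall i j, cbounded D (fun x => F x i j).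
Proof.
move=> cF Dab i j; have [/rAC_bounded[M _ hM] /rAC_bounded[N _ hN]] := cF i j.
exists (Num.max M N) => x /Dab xab.
by rewrite !le_max hM// hN// orbT.
Qed.

Lemma mAC_meas D m p (F : R -> 'M[C]_(m, p)) : open D ->
  (forall x, D x -> exists a b, a < x < b /\ mAC a b F) -> mmeas D F.
Proof.
move=> oD H i j; split; apply: open_continuous_measurable_fun => // x;
  rewrite inE => /H[a [b [xab]]].
  by move=> /(_ i j)[h _]; exact: rAC_continuous xab.
by move=> /(_ i j)[_ h]; exact: rAC_continuous xab.
Qed.

Lemma L2H_bounded D m (H : R -> 'M[C]_m) f : measurable D -> mint D H -> mmeas D f ->
  (forall i j, cbounded D (fun x => f x i j)) -> L2H D H f.
Proof.
move=> mD IH mf bf; split; first exact/mmeas_col.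
have I1 : mint D (fun x => H x *m f x) by exact: mint_mulmxb.
have : cintegrable D (fun x => Hform H f f x).
  rewrite (_ : (fun x => _) = fun x => \sum_k (H x *m f x) k 0 * conjc (f x k 0)).
    apply: cint_sum => // k; apply: cintMb => //.
      exact: (cmeasJ (mf k 0)).
    exact: (cbounded_conj (bf k 0)).
  apply/funext => x; rewrite /Hform -mulmxA mxE; apply: eq_bigr => k _.
  by rewrite adjmxE mulrC.
by move=> [h _]; exact: (@integrable_lty _ _ _ mu D mD _ h).
Qed.

Lemma loc_integrable_mmeas m (H : R -> 'M[C]_m) : loc_integrable_0oo H -> mmeas `]0, +oo[ H.
Proof.
move=> IH i j.
have E : `]0, +oo[%classic = \bigcup_n `[(n.+1%:R : R)^-1, n.+1%:R]%classic.
  apply/seteqP; split => [x /=|x [n _] /=]; rewrite !in_itv/= ?andbT.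
    move=> x0; exists (Num.trunc (Num.max x x^-1)) => //=; rewrite in_itv/=.
    have := truncnS_gt (Num.max x x^-1); rewrite gt_max => /andP[h1 h2].
    by rewrite (ltW h1) andbT -[leRHS]invrK lef_pV2 ?ltW// posrE ?invr_gt0.
  by move=> /andP[+ _]; apply: lt_le_trans; rewrite invr_gt0.
have I n : cintegrable `[(n.+1%:R : R)^-1, n.+1%:R] (fun x => H x i j).
  apply: IH; first by rewrite invr_gt0.
  by rewrite (@le_trans _ _ 1)// ?invf_le1// ler1n.
by rewrite E; split; apply/measurable_fun_bigcup => // n;
  have [h1 h2] := cint_measurable (I n).
Qed.

Lemma regular_mint m (H : R -> 'M[C]_m) (L : R) : loc_integrable_0oo H ->
  regular_endpoint0 H -> mint `]0, L] H.
Proof.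
move=> IH [c c0 Ic] i j.
pose b := Num.max L c.
have sub : `]0, L]%classic `<=` (`]0, c[%classic `|` `[c / 2, b]%classic : set R).
  move=> x /=; rewrite !in_itv/= => /andP[x0 xL].
  have [xc|cx] := ltP x c; [left|right]; first by rewrite x0.
  by rewrite /b le_max xL andbT (le_trans _ cx)// ler_pdivrMr// ler_peMr ?ler1n// ltW.
have [||h1 h2] := IH (c / 2) b _ _ i j.
- by rewrite divr_gt0.
- by rewrite /b le_max; apply/orP; right; rewrite ler_pdivrMr// ler_peMr ?ler1n// ltW.
have [k1 k2] := Ic i j.
have mU : measurable (`]0, c[%classic `|` `[c / 2, b]%classic : set R) by exact: measurableU.
by split; [apply: (rintS mU _ sub (rintU _ _ k1 h1))|apply: (rintS mU _ sub (rintU _ _ k2 h2))].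
Qed.

Lemma complex_ode_exists m (A : R -> 'M[C]_m) (L : R) (w0 : 'cV[C]_m) :
  mint `]0, L] A -> exists w : R -> 'cV[C]_m,
    [/\ w 0 = w0, forall s t, mAC s t w &
        {ae mu, forall x : R, 0 < x < L -> mderiv w x (A x *m w x)}].
Proof.
move=> IA.
pose Dp := (`]0, L] : set R)%classic.
(* The cutoff makes the coefficients integrable on the whole line and zero to the left of 0, as
   [linear_ode_exists] demands. *)
pose r i j := (fun x => Re (A x i j)) \_ Dp.
pose s i j := (fun x => Im (A x i j)) \_ Dp.
(* Realification: [true] marks an imaginary part and [false] a real part, so an entry a + ib becomes
   the 2 by 2 block with rows (a, -b) and (b, a). *)
pose B (p q : 'I_m * bool) : R -> R :=
  if p.2 then if q.2 then r p.1 q.1 else s p.1 q.1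
  else if q.2 then fun x => - s p.1 q.1 x else r p.1 q.1.
have mDp : measurable Dp by exact: measurable_itv.
have Ir i j : rint setT (r i j).
  rewrite /rint -restrict_EFin; apply/integrable_restrict => //; rewrite setTI; exact: (IA i j).1.
have Is i j : rint setT (s i j).
  rewrite /rint -restrict_EFin; apply/integrable_restrict => //; rewrite setTI; exact: (IA i j).2.
have IB p q : rint setT (B p q).
  by rewrite /B; case: p.2; case: q.2 => //; exact: rintN.
have pneg (f : R -> R) (x : R) : x <= 0 -> (f \_ Dp) x = 0.
  by move=> x0; rewrite patchE memNset// /Dp/= in_itv/= ltNge x0.
have B_neg p q (x : R) : x <= 0 -> B p q x = 0.
  by move=> x0; rewrite /B; case: p.2; case: q.2; rewrite /r /s ?pneg// oppr0.
have [z [z0 cz dz]] := @linear_ode_exists _ _ B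
  (fun p => if p.2 then Im (w0 p.1 0) else Re (w0 p.1 0)) IB B_neg.
pose w (x : R) : 'cV[C]_m := \col_i (z (i, false) x +i* z (i, true) x)%C.
have wr x i j : Re (w x i j) = z (i, false) x by rewrite mxE.
have wi x i j : Im (w x i j) = z (i, true) x by rewrite mxE.
exists w; split.
- apply/matrixP => i j; rewrite ord1; apply: ceqP; rewrite ?wr ?wi z0//.
- move=> a b i j; split.
    by under eq_fun do rewrite wr; exact: cz.
  by under eq_fun do rewrite wi; exact: cz.
- move: dz; apply: ae_mono => x dx /andP[x0 xL] i j.
  have pin (f : R -> R) : (f \_ Dp) x = f x.
    by rewrite patchE mem_set// /Dp/= in_itv/= x0 ltW.
  split.
    under eq_fun do rewrite wr; apply: (is_derive_eq (dx (i, false))).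
    rewrite mxE cRe_sum.
    rewrite [LHS](eq_bigr (fun p => B (i, false) (p.1, p.2) x * z (p.1, p.2) x)); last by case.
    rewrite -(pair_bigA _ (fun l e => B (i, false) (l, e) x * z (l, e) x))/=.
    apply: eq_bigr => k _; rewrite big_bool/= /B/= /r /s !pin cReM wr wi mulNr addrC.
    by [].
  under eq_fun do rewrite wi; apply: (is_derive_eq (dx (i, true))).
  rewrite mxE cIm_sum.
  rewrite [LHS](eq_bigr (fun p => B (i, true) (p.1, p.2) x * z (p.1, p.2) x)); last by case.
  rewrite -(pair_bigA _ (fun l e => B (i, true) (l, e) x * z (l, e) x))/=.
  by apply: eq_bigr => k _; rewrite big_bool/= /B/= /r /s !pin cImM wr wi.
Qed.

Lemma matrix_ode_exists m (A : R -> 'M[C]_m) (L : R) :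
  mint `]0, L] A -> exists U : R -> 'M[C]_m,
    [/\ U 0 = 1%:M, forall s t, mAC s t U &
        {ae mu, forall x : R, 0 < x < L -> mderiv U x (A x *m U x)}].
Proof.
move=> IA.
have /choice[w wP] (j : 'I_m) := complex_ode_exists (col j 1%:M) IA.
pose U x : 'M[C]_m := \matrix_(i, j) w j x i 0.
have UE x i j : U x i j = w j x i 0 by rewrite mxE.
exists U; split.
- by apply/matrixP => i j; rewrite UE; have [-> _ _] := wP j; rewrite mxE.
- move=> s t i j; have [_ /(_ s t i 0)[h1 h2] _] := wP j; split.
    by under eq_fun do rewrite UE.
  by under eq_fun do rewrite UE.
- have : forall j, {ae mu, forall x : R, 0 < x < L -> mderiv (w j) x (A x *m w j x)}.
    by move=> j; have [_ _] := wP j.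
  move/(@ae_fin _ 'I_m); apply: ae_mono => x H xL i j.
  have [h1 h2] := H j xL i 0.
  have E : (A x *m U x) i j = (A x *m w j x) i 0.
    by rewrite !mxE; apply: eq_bigr => k _; rewrite UE.
  rewrite E; split.
    by under eq_fun do rewrite UE.
  by under eq_fun do rewrite UE.
Qed.

End ComplexIntegrable.

(** * The canonical equation, Wronskians and matrix primitives *)

Section CanonicalEquation.
Context {R : realType}.
Local Notation C := (R[i]).
Local Notation mu := (@lebesgue_measure R).
Local Notation Re := complex.Re.
Local Notation Im := complex.Im.

Lemma Jmx_solve n p (A B : 'M[C]_(n + n, p)) :
  Jmx n *m A = - B <-> A = Jmx n *m B.
Proof.
split=> [h|->]; last by rewrite mulmxA Jmx_sq mulNmx mul1mx.
have : Jmx n *m (Jmx n *m A) = - A by rewrite mulmxA Jmx_sq mulNmx mul1mx.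
by rewrite h mulmxN => /oppr_inj.
Qed.

Lemma canon_eqE n p (D : set R) (H : R -> 'M[C]_(n + n)) (F G : R -> 'M[C]_(n + n, p)) :
  canon_eq D H F G <->
  {ae mu, forall x, D x -> mderiv F x (Jmx n *m (H x *m G x))}.
Proof.
split; apply: ae_mono => x h /h.
  by move=> [dF [dFx /Jmx_solve <-]].
by move=> d; exists (Jmx n *m (H x *m G x)); split => //; exact/Jmx_solve.
Qed.

Lemma canon_eqS n p (D E : set R) (H : R -> 'M[C]_(n + n)) (F G : R -> 'M[C]_(n + n, p)) :
  E `<=` D -> canon_eq D H F G -> canon_eq E H F G.
Proof. by move=> ED; apply: ae_mono => x h /ED; exact: h. Qed.

(** Taking the adjoint turns the parameter [conjc z] of [G] back into [z], and [A] is Hermitian. The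
    two terms of the product rule are thus the same multiple of [adjmx (G x) *m A *m F x], with
    opposite signs because [Jmx n] squares to -1. *)
Lemma wronskian_deriv n p q (A : 'M[C]_(n + n)) (z : C) (F : R -> 'M[C]_(n + n, p))
    (G : R -> 'M[C]_(n + n, q)) x : adjmx A = A ->
  mderiv F x (Jmx n *m (A *m (z *: F x))) ->
  mderiv G x (Jmx n *m (A *m (conjc z *: G x))) ->
  mderiv (fun t => adjmx (G t) *m (Jmx n *m F t)) x 0.
Proof.
move=> hA dF dG.
have := mderiv_mulmx (mderiv_adj dG) (mderiv_mulmx (mderiv_cst (Jmx n) x) dF).
set W := adjmx (G x) *m A *m F x.
have -> : adjmx (Jmx n *m (A *m (conjc z *: G x))) *m (Jmx n *m F x) = z *: W.
  rewrite !adjmxM adjmxZ adjmx_Jmx hA conjcK mulmxN mulNmx mulmxA.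
  by rewrite -(mulmxA _ (Jmx n) (Jmx n)) Jmx_sq mulmxN mulmx1 mulNmx opprK -!scalemxAl.
have -> : adjmx (G x) *m (0 *m F x + Jmx n *m (Jmx n *m (A *m (z *: F x)))) = - (z *: W).
  rewrite mul0mx add0r (mulmxA (Jmx n)) Jmx_sq mulNmx mul1mx mulmxN -!scalemxAr.
  by rewrite mulmxA.
by rewrite subrr.
Qed.

(** Cut off at [L], the primitive is zero up to that point, so it can be added as a correction to a
    function already given on the left. *)
Lemma mprimitive_exists m p (q : R -> 'M[C]_(m, p)) (L : R) :
  (forall y, mint `]L, y] q) -> exists Q : R -> 'M[C]_(m, p),
    [/\ forall x, x <= L -> Q x = 0, forall s t, mAC s t Q &
        {ae mu, forall x : R, L < x -> mderiv Q x (q x)}].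
Proof.
move=> Iq.
pose D := (`]L, +oo[ : set R)%classic.
pose r i j := (fun x => Re (q x i j)) \_ D.
pose s i j := (fun x => Im (q x i j)) \_ D.
have mD : measurable D by exact: measurable_itv.
have DE y : `]-oo, y]%classic `&` D = (`]L, y] : set R)%classic.
  apply/seteqP; split => x; rewrite /D/= !in_itv/= !andbT; first by move=> [-> ->].
  by move=> /andP[].
have Lr i j : lintegrable (r i j).
  move=> y; rewrite -restrict_EFin; apply/integrable_restrict => //.
  by rewrite DE; exact: (Iq y i j).1.
have Ls i j : lintegrable (s i j).
  move=> y; rewrite -restrict_EFin; apply/integrable_restrict => //.
  by rewrite DE; exact: (Iq y i j).2.
pose Q x : 'M[C]_(m, p) := \matrix_(i, j) (primitive (r i j) x +i* primitive (s i j) x)%C.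
have Qr x i j : Re (Q x i j) = primitive (r i j) x by rewrite mxE.
have Qi x i j : Im (Q x i j) = primitive (s i j) x by rewrite mxE.
have p0 (f : R -> R) (x : R) : x <= L -> (f \_ D) x = 0.
  by move=> xL; rewrite patchE memNset// /D/= in_itv/= andbT ltNge xL.
exists Q; split.
- move=> x xL; apply/matrixP => i j; apply: ceqP; rewrite ?Qr ?Qi mxE primitive_eq0// => t tx.
    by rewrite /r p0// (le_trans tx).
  by rewrite /s p0// (le_trans tx).
- move=> a b i j; split.
    by under eq_fun do rewrite Qr; exact: primitive_rAC.
  by under eq_fun do rewrite Qi; exact: primitive_rAC.
- have h1 i j := primitive_derive (Lr i j); have h2 i j := primitive_derive (Ls i j).
  have := ae_fin (fun i => ae_fin (fun j => ae_and (h1 i j) (h2 i j))).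
  apply: ae_mono => x h xL i j; have [d1 d2] := h i j.
  have pin (f : R -> R) : (f \_ D) x = f x.
    by rewrite patchE mem_set// /D/= in_itv/= xL.
  split.
    by under eq_fun do rewrite Qr; move: d1; rewrite {2}/r pin.
  by under eq_fun do rewrite Qi; move: d2; rewrite {2}/s pin.
Qed.

End CanonicalEquation.

(** * The tail, where [H] is the projection [adjmx beta *m beta] *)

Section TailWeight.
Context {R : realType} (n : nat).
Local Notation C := (R[i]).
Local Notation mu := (@lebesgue_measure R).
Local Notation Re := complex.Re.
Local Notation Im := complex.Im.
Variables (H : R -> 'M[C]_(n + n)) (alpha beta : 'M[C]_(n, n + n)) (L : R).
Hypotheses (locH : loc_integrable_0oo H)
  (psdH : {ae mu, forall x, 0 < x -> psdmx (H x)})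
  (regH : regular_endpoint0 H)
  (bb : beta *m adjmx beta = 1%:M) (bJb : beta *m Jmx n *m adjmx beta = 0)
  (L0 : 0 < L) (HL : forall x, L < x -> H x = adjmx beta *m beta).

Local Notation D0 := (`]0, +oo[%classic : set R).
Local Notation DL := (`]0, L[%classic : set R).
Local Notation DI := (`]L, +oo[%classic : set R).

Let D0E (x : R) : D0 x = (0 < x). Proof. by rewrite /= in_itv/= andbT. Qed.
Let DIE (x : R) : DI x = (L < x). Proof. by rewrite /= in_itv/= andbT. Qed.
Let DLE (x : R) : DL x = (0 < x < L). Proof. by rewrite /= in_itv. Qed.
Let subL : DL `<=` D0. Proof. by move=> x; rewrite DLE D0E => /andP[]. Qed.
Let subI : DI `<=` D0. Proof. by move=> x; rewrite DIE D0E; exact: lt_trans. Qed.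
Let m0 : measurable D0. Proof. exact: measurable_itv. Qed.
Let mL : measurable DL. Proof. exact: measurable_itv. Qed.
Let mI : measurable DI. Proof. exact: measurable_itv. Qed.
Let mH0 : mmeas D0 H. Proof. exact: loc_integrable_mmeas. Qed.
Let mHL : mmeas DL H. Proof. exact: mmeasS mH0. Qed.
Let mHI : mmeas DI H. Proof. exact: mmeasS mH0. Qed.
Let p0 : {ae mu, forall x, D0 x -> psdmx (H x)}.
Proof. by move: psdH; apply: ae_mono => x h; rewrite D0E. Qed.
Let pL : {ae mu, forall x, DL x -> psdmx (H x)}.
Proof. by move: p0; apply: ae_mono => x h /subL. Qed.
Let pI : {ae mu, forall x, DI x -> psdmx (H x)}.
Proof. by move: p0; apply: ae_mono => x h /subI. Qed.
Let intL : mint DL H.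
Proof.
have I := regular_mint L locH regH.
have s : DL `<=` (`]0, L]%classic : set R).
  by move=> x; rewrite DLE /= in_itv/= => /andP[-> /ltW ->].
move=> i j; have [h1 h2] := I i j.
by split; [apply: (rintS _ _ s h1)|apply: (rintS _ _ s h2)].
Qed.

Lemma ae_split (P : R -> Prop) :
  {ae mu, forall x, DL x -> P x} -> {ae mu, forall x, DI x -> P x} ->
  {ae mu, forall x, D0 x -> P x}.
Proof.
move=> h1 h2; have := ae_and (ae_neq L) (ae_and h1 h2).
apply: ae_mono => x [xL [h3 h4]]; rewrite D0E => x0.
have [lt|gt|E] := ltgtP x L.
- by apply: h3; rewrite DLE x0.
- by apply: h4; rewrite DIE.
- by move: xL; rewrite E eqxx.
Qed.

Lemma beta_const p (F G : R -> 'M[C]_(n + n, p)) c x : L <= c -> c <= x ->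
  mAC c x F -> canon_eq D0 H F G -> beta *m F x = beta *m F c.
Proof.
move=> Lc cx cF /canon_eqE dF.
apply: (@mAC_const _ _ _ c x (fun t => beta *m F t)) => //.
  by apply: mAC_mulmx => //; exact: mAC_cst.
move: dF; apply: ae_mono => t dt /andP[ct tx].
have Lt : L < t by exact: le_lt_trans ct.
have t0 : D0 t by rewrite D0E (lt_trans L0).
have := mderiv_mulmx (mderiv_cst beta t) (dt t0).
by rewrite mul0mx add0r (HL Lt) !mulmxA bJb !mul0mx.
Qed.

Lemma tail_null p (w : 'M[C]_(n + n, p)) x : L < x -> beta *m w = 0 -> H x *m w = 0.
Proof. by move=> Lx bw; rewrite (HL Lx) -mulmxA bw mulmx0. Qed.

Lemma tail_form f x : L < x -> Hform H f f x = (adjmx (beta *m f x) *m (beta *m f x)) 0 0.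
Proof. by move=> Lx; rewrite /Hform (HL Lx) adjmxM !mulmxA. Qed.

Lemma tail_L2 f (k : 'cV[C]_n) : (forall x, L < x -> beta *m f x = k) ->
  L2H DI H f -> k = 0.
Proof.
move=> fk [mf nf]; apply: normsq_col_eq0; set c := Re _.
have c0 : 0 <= c.
  by rewrite /c normsq_col; apply: sumr_ge0 => i _; rewrite addr_ge0// sqr_ge0.
have E : Hnorm2 DI H f = (\int[mu]_(x in DI) (cst c%:E) x)%E.
  by apply: eq_integral => x; rewrite inE DIE => Lx /=; rewrite tail_form// fk.
have muI : mu DI = +oo%E by rewrite lebesgue_measure_itv/= ltry.
have E2 : (\int[mu]_(x in DI) (cst c%:E) x = c%:E * +oo)%E.
  by rewrite integral_cst//; congr (_ * _)%E; exact: muI.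
move: nf; rewrite E E2.
apply: contraTeq => cn; rewrite gt0_muley ?ltxx// lte_fin lt_neqAle eq_sym cn//.
Qed.

Lemma AC_meas0 p (F : R -> 'M[C]_(n + n, p)) :
  (forall a b, 0 < a -> a <= b -> mAC a b F) -> mmeas D0 F.
Proof.
move=> cF; apply: mAC_meas; first exact: interval_open.
move=> x; rewrite D0E => x0; exists (x / 2), (x + 1); split.
  by rewrite ltrDl ltr01 andbT ltr_pdivrMr// ltr_pMr// ltr1n.
apply: cF; first by rewrite divr_gt0.
by rewrite ler_wpDr// ler_pdivrMr// ler_peMr// ?ltW// ltr1n.
Qed.

Lemma AC_measL p (F : R -> 'M[C]_(n + n, p)) : mAC 0 L F -> mmeas DL F.
Proof.
move=> cF; apply: mAC_meas; first exact: interval_open.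
by move=> x; rewrite DLE => xL; exists 0, L.
Qed.

Let Srel_AC F : (forall b, 0 < b -> mAC 0 b F) -> forall a b : R, 0 < a -> a <= b ->
  mAC a b (F : R -> 'cV[C]_(n + n)).
Proof.
move=> cF a b a0 ab; apply: (mACS (ltW a0) (lexx b)); apply: cF.
exact: lt_le_trans ab.
Qed.

(** * The decomposition of the relation *)

Lemma Srel_Sab f g : Srel H alpha f g -> Sab H alpha beta L f g /\ Hnull DI H f.
Proof.
move=> [Lf [Lg [f0 [cf0 ef0 df0 af0]]]].
have mf0 := AC_meas0 (Srel_AC cf0).
have mf : mmeas D0 f by exact/mmeas_col/Lf.1.
have fe := (Hequiv_ae m0 mH0 p0 mf mf0).1 ef0.
have bc x : L <= x -> beta *m f0 x = beta *m f0 L.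
  move=> Lx; apply: (beta_const (lexx L) Lx _ df0).
  by apply: (mACS (ltW L0) (lexx x)); apply: cf0; exact: lt_le_trans Lx.
(* Only the representative [f0] has constant [beta *m f0 x] on the tail, so square integrability is
   first carried over from [f] to [f0]. *)
have bf0 : beta *m f0 L = 0.
  apply: (@tail_L2 f0) => [x Lx|]; first by apply: bc; exact: ltW.
  exact: (L2H_sub m0 mH0 p0 mI subI (L2H_ae m0 mH0 p0 mf0 fe Lf)).
split.
  split; first exact: (L2H_sub m0 mH0 p0 mL subL Lf).
  split; first exact: (L2H_sub m0 mH0 p0 mL subL Lg).
  exists f0; split; [exact: cf0| | |exact: af0|exact: bf0].
  - apply/(Hequiv_ae mL mHL pL); [exact: mmeasS mf|exact: mmeasS mf0|].
    by move: fe; apply: ae_mono => x h /subL.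
  - exact: canon_eqS df0.
apply/(Hnull_ae mI mHI pI); first exact: mmeasS mf.
move: fe; apply: ae_mono => x h; move=> Dx; rewrite h; last exact: subI.
move: Dx; rewrite DIE => Lx.
by apply: tail_null => //; rewrite bc// ltW.
Qed.

(** On a bounded interval square integrability gives integrability, through |a| <= 1 + a^2 + b^2. On
    the tail the form controls only [beta *m g x], not [g] itself. *)
Lemma tail_integrable g : L2H DI H g -> forall y, mint `]L, y] (fun x => beta *m g x).
Proof.
move=> [/mmeas_col mg ng] y i j; rewrite ord1.
have If : rint DI (fun x => Re (Hform H g g x)).
  apply/integrableP; split; first by apply/measurable_EFinP; exact: Hform_measurable.
  by rewrite -[ltLHS](Hnorm2_abs mI mHI pI).
have s : `]L, y]%classic `<=` DI.
  by move=> x; rewrite DIE /= in_itv/= => /andP[].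
have mY : measurable (`]L, y]%classic : set R) by exact: measurable_itv.
have I1 : rint `]L, y] (fun x => 1 + Re (Hform H g g x)).
  apply: (rintD mY); last exact: (rintS mI mY s If).
  apply/integrableP; split; first exact: measurable_cst.
  rewrite (eq_integral (cst 1%E)) => [|x _]; last by rewrite /= normr1.
  rewrite integral_cst// mul1e [ltLHS]lebesgue_measure_itv/=.
  by case: ifPn => // _; rewrite -EFinB ltry.
have [h1 h2] : cmeasurable `]L, y] (fun x => (beta *m g x) i 0).
  by apply: (mmeasS mI s); apply: mmeas_mulmx => //; exact: mmeas_cst.
have bnd x : `]L, y]%classic x ->
    Re ((beta *m g x) i 0) ^+ 2 + Im ((beta *m g x) i 0) ^+ 2 <= Re (Hform H g g x).
  move=> /s; rewrite DIE => Lx; rewrite tail_form// normsq_col (bigD1 i)//= lerDl.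
  by apply: sumr_ge0 => k _; rewrite addr_ge0// sqr_ge0.
have le1 (a b c : R) : a ^+ 2 + b ^+ 2 <= c -> `|a| <= 1 + c.
  by move=> h; rewrite ler_norml; apply/andP; split; nra.
split; apply: (rint_le mY _ _ I1) => // x /bnd.
  exact: le1.
by rewrite addrC; exact: le1.
Qed.

Lemma Sab_Srel f g : L2H D0 H f -> L2H D0 H g ->
  Sab H alpha beta L f g -> Hnull DI H f -> Srel H alpha f g.
Proof.
move=> Lf Lg [_ [_ [f0 [cf0 ef0 df0 af0 bf0]]]] nf.
have mf : mmeas D0 f by exact/mmeas_col/Lf.1.
(* This is J H g on the tail, bracketed so that only the integrable factor [beta *m g x] is
   integrated. *)
pose q x := (Jmx n *m adjmx beta) *m (beta *m g x).
have Iq y : mint `]L, y] q.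
  apply: mint_mulmxl; first exact: measurable_itv.
  exact: (tail_integrable (L2H_sub m0 mH0 p0 mI subI Lg)).
have [Q [Q0 cQ dQ]] := mprimitive_exists Iq.
(* The first term is frozen at [f0 L] beyond [L] and the second is zero before [L], so the pieces
   match at [L] without a case distinction. *)
pose F x := f0 (Num.min x L) + Q x.
have FL x : x <= L -> F x = f0 x by move=> xL; rewrite /F (min_idPl xL) Q0// addr0.
have FI x : L <= x -> F x = f0 L + Q x by move=> xL; rewrite /F (min_idPr xL).
have cF b : 0 < b -> mAC 0 b F.
  move=> b0; apply: (@mACS _ _ _ 0 (Num.max b L)) => //; first by rewrite le_max lexx.
  apply: (@mAC_glue _ _ _ _ L); first exact: ltW.
  - by rewrite le_max lexx orbT.
  - by apply: mAC_eq cf0 => x /andP[_ xL]; rewrite FL.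
  - apply: (@mAC_eq _ _ _ _ _ (fun x => f0 L + Q x)) => [x /andP[Lx _]|]; first by rewrite FI.
    by apply: mACD; [exact: mAC_cst|exact: cQ].
have dF : canon_eq D0 H F g.
  apply/canon_eqE; apply: ae_split.
    move/canon_eqE : df0; apply: ae_mono => x h Dx.
    apply: (mderiv_near (c := 0) (d := L) _ _ (h Dx)); first by rewrite -DLE.
    by move=> t /andP[_ /ltW tL]; rewrite FL.
  move: dQ; apply: ae_mono => x h; rewrite DIE => Lx.
  have hd := mderivD (mderiv_cst (f0 L) x) (h Lx).
  rewrite add0r in hd.
  rewrite (HL Lx) !mulmxA; move: hd; rewrite /q !mulmxA.
  apply: (mderiv_near (c := L) (d := x + 1)); first by rewrite Lx ltrDl ltr01.
  by move=> t /andP[/ltW Lt _]; rewrite FI.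
split; first exact: Lf.
split; first exact: Lg.
exists F; split; [exact: cF| |exact: dF|].
- have mF := AC_meas0 (Srel_AC cF).
  apply/(Hequiv_ae m0 mH0 p0 mf mF); apply: ae_split.
    have mf0 := AC_measL cf0.
    have /(Hequiv_ae mL mHL pL) fe := ef0.
    have := fe (mmeasS m0 subL mf) mf0; apply: ae_mono => x h Dx.
    by rewrite h// FL//; move: Dx; rewrite DLE => /andP[_ /ltW].
  (* On the tail the prolongation may differ from [f] as a function, but [beta *m F x] keeps the
     value [beta *m f0 L = 0], so both represent the zero class there. *)
  move/(Hnull_ae mI mHI pI (mmeasS m0 subI mf)) : nf; apply: ae_mono => x h Dx.
  rewrite h//; move: Dx; rewrite DIE => Lx; rewrite tail_null//.
  rewrite (beta_const (lexx L) (ltW Lx) _ dF) ?FL//.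
  by apply: (mACS (ltW L0) (lexx x)); apply: cF; exact: lt_trans Lx.
- by rewrite FL// ltW.
Qed.

Lemma L2H_join f : mmeas D0 f -> L2H DL H f ->
  {ae mu, forall x, DI x -> H x *m f x = 0} -> L2H D0 H f.
Proof.
move=> mf [_ nf] f0; split; first exact/mmeas_col.
rewrite (Hnorm2_split L0 mH0 psdH mf).
have -> : Hnorm2 DI H f = 0%E by apply/(Hnull_ae mI mHI pI) => //; exact: mmeasS mf.
by rewrite adde0.
Qed.

Lemma L2H_AC f : (forall b : R, 0 < b -> mAC 0 b f) ->
  (forall x, L < x -> beta *m f x = 0) -> L2H D0 H f.
Proof.
move=> cf bf; have mf := AC_meas0 (Srel_AC cf).
apply: L2H_join => //; last first.
  by apply: aeW => x; rewrite DIE => Lx; rewrite tail_null// bf.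
apply: L2H_bounded => //; first exact: mmeasS mf.
apply: (mAC_cbounded (cf L L0)) => x; rewrite DLE => /andP[x0 xL].
by rewrite !ltW.
Qed.

(** * Square integrable solutions and the boundary condition at [L] *)

Lemma m_function_iff (z : C) i1 i2 (u v : R -> 'M[C]_(n + n, n)) (M : 'M[C]_n) :
  msol H z i1 u -> msol H z i2 v ->
  (forall j : 'I_n, L2H D0 H (fun x => col j (v x + u x *m M))) <->
  beta *m (v L + u L *m M) = 0.
Proof.
move=> [cu _ du] [cv _ dv].
pose w x := v x + u x *m M.
have cw b : 0 < b -> mAC 0 b w.
  move=> b0; apply: mACD; first exact: cv.
  by apply: mAC_mulmx; [exact: cu|exact: mAC_cst].
have dw : canon_eq D0 H w (fun x => z *: w x).
  move/canon_eqE : du => du; move/canon_eqE : dv => dv; apply/canon_eqE.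
  have := ae_and du dv; apply: ae_mono => x [h1 h2] Dx.
  have := mderivD (h2 Dx) (mderiv_mulmx (h1 Dx) (mderiv_cst M x)).
  congr mderiv; rewrite mulmx0 addr0 /w scalerDr !mulmxDr; congr (_ + _).
  by rewrite -!mulmxA -scalemxAl.
have bw x : L <= x -> beta *m w x = beta *m w L.
  move=> Lx; apply: (beta_const (lexx L) Lx _ dw).
  by apply: (mACS (ltW L0) (lexx x)); apply: cw; exact: lt_le_trans Lx.
have bcol j x : L < x -> beta *m col j (w x) = col j (beta *m w L).
  by move=> Lx; rewrite !colE mulmxA bw// ltW.
split=> [h|h j].
  apply/matrixP => i j; have /matrixP/(_ i 0) : col j (beta *m w L) = 0.
    apply: (@tail_L2 (fun x => col j (w x))); first exact: bcol.
    exact: (L2H_sub m0 mH0 p0 mI subI (h j)).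
  by rewrite !mxE.
apply: L2H_AC => [b b0|x Lx].
  apply: (@mAC_eq _ _ _ _ _ (fun x => w x *m delta_mx j 0)) => [x _|]; first by rewrite colE.
  by apply: mAC_mulmx; [exact: cw|exact: mAC_cst].
by rewrite -/(w x) bcol// /w h colE mul0mx.
Qed.

(** * Extension by zero and the operator parts *)

Definition zext (f : R -> 'cV[C]_(n + n)) x := if x < L then f x else 0.

Lemma zext_in f x : DL x -> zext f x = f x.
Proof. by rewrite DLE /zext => /andP[_ ->]. Qed.

Lemma zext_out f x : DI x -> zext f x = 0.
Proof. by rewrite DIE /zext => Lx; rewrite ltNge (ltW Lx). Qed.

Lemma mmeas_zext f : mmeas DL f -> mmeas D0 (zext f).
Proof.
move=> mf.
have E0 : D0 = DL `|` (`[L, +oo[%classic : set R).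
  apply/seteqP; split => x; rewrite ?D0E.
    by move=> x0; have [xL|Lx] := ltP x L; [left; rewrite DLE x0|right; rewrite /= in_itv/= Lx].
  move=> []; rewrite ?DLE /= ?in_itv/=; first by case/andP.
  by rewrite andbT; exact: lt_le_trans.
move=> i j; have m1 : mmeas DL (zext f) by apply: mmeas_eq mf => x Dx; rewrite zext_in.
have m2 : mmeas (`[L, +oo[%classic : set R) (zext f).
  apply: (mmeas_eq _ (mmeas_cst _ 0)) => x /=.
  by rewrite in_itv/= andbT /zext ltNge => ->.
have [h1 h2] := m1 i j; have [k1 k2] := m2 i j.
by rewrite E0; split; apply/measurable_funU.
Qed.

Lemma L2H_zext f : L2H DL H f -> L2H D0 H (zext f).
Proof.
move=> Lf; have mf : mmeas DL f by exact/mmeas_col/Lf.1.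
apply: L2H_join; first exact: mmeas_zext.
  by apply: eq_L2H Lf => x Dx; rewrite zext_in.
by apply: aeW => x Dx; rewrite zext_out// mulmx0.
Qed.

(** This is what moves an approximating element of the domain from (0, L) to (0, oo) when closures
    are compared. *)
Lemma Sab_zext f g : Sab H alpha beta L f g -> Srel H alpha (zext f) (zext g).
Proof.
move=> [Lf [Lg [f0 [cf0 ef0 df0 af0 bf0]]]].
have mf : mmeas DL f by exact/mmeas_col/Lf.1.
apply: Sab_Srel; [exact: L2H_zext|exact: L2H_zext| |]; last first.
  apply/(Hnull_ae mI mHI pI); first exact: (mmeasS m0 subI (mmeas_zext mf)).
  by apply: aeW => x Dx; rewrite zext_out// mulmx0.
split; first by apply: eq_L2H Lf => x Dx; rewrite zext_in.
split; first by apply: eq_L2H Lg => x Dx; rewrite zext_in.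
exists f0; split; [exact: cf0| | |exact: af0|exact: bf0].
  rewrite /Hequiv /Hnull -[RHS]ef0; apply: eq_Hnorm2 => x Dx.
  by rewrite zext_in.
move: df0; apply: ae_mono => x h Dx; have [dF [h1 h2]] := h Dx.
by exists dF; split; [exact: h1|rewrite zext_in].
Qed.

(** Elements of the domain on (0, oo) are null on the tail, and the closure inherits this because
    restriction does not increase the norm. Requiring [g] to lie in that closure thus removes the
    purely multivalued summand. On (0, L) the closures agree: approximants are transported by
    restriction one way and by [zext] the other. *)
Lemma op_part_iff f g : L2H D0 H f -> L2H D0 H g ->
  op_part D0 H (Srel H alpha) f g <->
  [/\ op_part DL H (Sab H alpha beta L) f g, Hnull DI H f & Hnull DI H g].
Proof.
move=> Lf Lg.
have mf : mmeas D0 f by exact/mmeas_col/Lf.1.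
have mg : mmeas D0 g by exact/mmeas_col/Lg.1.
have cl_null h : L2H D0 H h -> Hclosure D0 H (rel_dom (Srel H alpha)) h -> Hnull DI H h.
  move=> Lh [_ ch]; have mh : mmeas D0 h by exact/mmeas_col/Lh.1.
  apply/eqP; rewrite eq_le; apply/andP; split; last first.
    rewrite (Hnorm2_abs mI mHI pI (mmeasS m0 subI mh)).
    by apply: integral_ge0 => x _; rewrite lee_fin.
  apply/lee_addgt0Pr => e e0; rewrite add0e.
  have [k [k' Sk] hk] := ch e e0.
  have [[Lk _] nk] := (Sk, (Srel_Sab Sk).2).
  have mk : mmeas D0 k by exact/mmeas_col/Lk.1.
  have mhk : mmeas D0 (fun x => h x - k x) by exact: mmeasB.
  (* Subtracting the approximant [k], which is null on the tail, does not change the tail norm of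
     [h], so that norm is below every [e]. *)
  have -> : Hnorm2 DI H h = Hnorm2 DI H (fun x => h x - k x).
    apply: (Hnorm2_ae mI mHI pI); [exact: (mmeasS m0 subI mh)|exact: (mmeasS m0 subI mhk)|].
    move/(Hnull_ae mI mHI pI (mmeasS m0 subI mk)) : nk; apply: ae_mono => x hx Dx.
    by rewrite mulmxBr hx// subr0.
  exact: (le_trans (Hnorm2_le m0 mH0 p0 mI subI mhk) (ltW hk)).
have cl_res h : L2H D0 H h -> Hclosure D0 H (rel_dom (Srel H alpha)) h ->
    Hclosure DL H (rel_dom (Sab H alpha beta L)) h.
  move=> Lh [_ ch]; split; first exact: (L2H_sub m0 mH0 p0 mL subL Lh).
  move=> e e0; have [k [k' Sk] hk] := ch e e0.
  exists k; first by exists k'; exact: (Srel_Sab Sk).1.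
  apply: le_lt_trans hk; apply: (Hnorm2_le m0 mH0 p0 mL subL).
  apply: mmeasB; first exact/mmeas_col/Lh.1.
  by have [Lk _] := Sk; exact/mmeas_col/Lk.1.
have cl_ext h : L2H D0 H h -> Hnull DI H h ->
    Hclosure DL H (rel_dom (Sab H alpha beta L)) h ->
    Hclosure D0 H (rel_dom (Srel H alpha)) h.
  move=> Lh nh [_ ch]; split; first exact: Lh.
  move=> e e0; have [k [k' Sk] hk] := ch e e0.
  have mh : mmeas D0 h by exact/mmeas_col/Lh.1.
  exists (zext k); first by exists (zext k'); exact: Sab_zext.
  have mk : mmeas DL k by have [Lk _] := Sk; exact/mmeas_col/Lk.1.
  have mhk : mmeas D0 (fun x => h x - zext k x) by apply: mmeasB => //; exact: mmeas_zext.
  rewrite (Hnorm2_split L0 mH0 psdH mhk).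
  rewrite (@eq_Hnorm2 _ DI _ H _ h) => [|x Dx]; last by rewrite zext_out// subr0.
  rewrite nh adde0 (@eq_Hnorm2 _ DL _ H _ (fun x => h x - k x)) => [//|x Dx].
  by rewrite zext_in.
split=> [[Sfg cf cg]|[[Sfg cf cg] nf ng]].
  split; [split|exact: (Srel_Sab Sfg).2|exact: cl_null].
  - exact: (Srel_Sab Sfg).1.
  - exact: cl_res.
  - exact: cl_res.
split; [exact: Sab_Srel|exact: cl_ext|exact: cl_ext].
Qed.

(** * Fundamental matrices and deficiency indices *)

Lemma fundamental_exists (z : C) : exists U : R -> 'M[C]_(n + n),
  [/\ U 0 = 1%:M, forall s t, mAC s t U &
      {ae mu, forall x : R, 0 < x < L -> mderiv U x (Jmx n *m (H x *m (z *: U x)))}].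
Proof.
have I : mint `]0, L] (fun x => (z *: Jmx n) *m H x).
  by apply: mint_mulmxl; [exact: measurable_itv|exact: regular_mint].
have [U [U0 cU dU]] := matrix_ode_exists I.
exists U; split; [exact: U0|exact: cU|].
move: dU; apply: ae_mono => x h /h; congr mderiv.
by rewrite -mulmxA -scalemxAl -!scalemxAr.
Qed.

Lemma wronskian_const p q (z : C) (F : R -> 'M[C]_(n + n, p)) (G : R -> 'M[C]_(n + n, q)) a b :
  0 <= a -> a <= b -> b <= L -> mAC a b F -> mAC a b G ->
  {ae mu, forall x : R, 0 < x < L -> mderiv F x (Jmx n *m (H x *m (z *: F x)))} ->
  {ae mu, forall x : R, 0 < x < L -> mderiv G x (Jmx n *m (H x *m (conjc z *: G x)))} ->
  adjmx (G b) *m (Jmx n *m F b) = adjmx (G a) *m (Jmx n *m F a).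
Proof.
move=> a0 ab bL cF cG dF dG.
apply: (@mAC_const _ _ _ a b (fun x => adjmx (G x) *m (Jmx n *m F x))) => //.
  by apply: mAC_mulmx; [exact: mAC_adj|apply: mAC_mulmx => //; exact: mAC_cst].
have := ae_and psdH (ae_and dF dG); apply: ae_mono => x [px [h1 h2]] /andP[ax xb].
have x0 : 0 < x by exact: le_lt_trans ax.
have xL : 0 < x < L by rewrite x0 (lt_le_trans xb).
exact: (wronskian_deriv (psdmx_herm (px x0)) (h1 xL) (h2 xL)).
Qed.

Lemma fundamental_wronskian (z : C) (U V : R -> 'M[C]_(n + n)) x : 0 <= x <= L ->
  U 0 = 1%:M -> V 0 = 1%:M -> (forall s t, mAC s t U) -> (forall s t, mAC s t V) ->
  {ae mu, forall x : R, 0 < x < L -> mderiv U x (Jmx n *m (H x *m (z *: U x)))} ->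
  {ae mu, forall x : R, 0 < x < L -> mderiv V x (Jmx n *m (H x *m (conjc z *: V x)))} ->
  adjmx (V x) *m (Jmx n *m U x) = Jmx n.
Proof.
move=> /andP[x0 xL] U0 V0 cU cV dU dV.
rewrite (@wronskian_const _ _ z U V 0 x)//.
by rewrite U0 V0 adjmx1 mul1mx mulmx1.
Qed.

(* [beta] and [beta J] are the rows of a unitary matrix. *)
Lemma ker_beta p (v : 'M[C]_(n + n, p)) : beta *m v = 0 ->
  v = Jmx n *m adjmx beta *m (- (beta *m Jmx n *m v)).
Proof.
move=> bv; pose W := col_mx beta (beta *m Jmx n).
have W1 : W *m row_mx (adjmx beta) (- (Jmx n *m adjmx beta)) = 1%:M.
  rewrite mul_col_row bb bJb !mulmxN !mulmxA -(mulmxA beta (Jmx n) (Jmx n)) Jmx_sq.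
  by rewrite bJb mulmxN mulmx1 mulNmx opprK bb oppr0 -scalar_mx_block.
have := mulmx1C W1; rewrite mul_row_col => E.
rewrite -[LHS]mul1mx -E mulmxDl -(mulmxA _ beta v) bv mulmx0 add0r.
by rewrite !mulNmx mulmxN !mulmxA.
Qed.

(** The index is the dimension of ker [beta]: a value in this kernel at [L] is continued to the left
    by the fundamental matrix and to the right as a constant, since [H] annihilates it on the tail.
    The argument is uniform in [z], real or not. *)
Lemma deficiency (z : C) : definite_on DL H -> deficiency_index H z n.
Proof.
move=> defH.
have [U [U0 cU dU]] := fundamental_exists z.
have [V [V0 cV dV]] := fundamental_exists (conjc z).
have VU x : 0 <= x <= L -> adjmx (V x) *m (Jmx n *m U x) = Jmx n.
  by move=> xL; exact: (fundamental_wronskian xL U0 V0 cU cV dU dV).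
(* A vector is determined by its Wronskian against the fundamental matrix for [conjc z]; this
   replaces a uniqueness theorem below. *)
have VJinj x (d : 'cV[C]_(n + n)) : 0 <= x <= L -> adjmx (V x) *m (Jmx n *m d) = 0 -> d = 0.
  move=> xL; have VUx := VU x xL.
  have /mulmx1C E : (- (Jmx n *m adjmx (V x) *m Jmx n)) *m U x = 1%:M.
    by rewrite mulNmx -!mulmxA VUx Jmx_sq opprK.
  by move=> h; rewrite -[d]mul1mx -E mulmxN mulNmx -!mulmxA h !mulmx0 oppr0.
have UL : invmx (U L) *m U L = 1%:M /\ U L *m invmx (U L) = 1%:M.
  have LL : 0 <= L <= L by rewrite lexx ltW.
  have E : (- (Jmx n *m adjmx (V L) *m Jmx n)) *m U L = 1%:M.
    by rewrite mulNmx -!mulmxA VU// Jmx_sq opprK.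
  have [_ UU] := mulmx1_unit E.
  by rewrite mulVmx// mulmxV.
(* Normalised so that [F L = Jmx n *m adjmx beta], whose columns span ker [beta] by [ker_beta]. *)
pose K := invmx (U L) *m (Jmx n *m adjmx beta).
pose F x : 'M[C]_(n + n, n) := U (Num.min x L) *m K.
have FL x : x <= L -> F x = U x *m K by move=> xL; rewrite /F (min_idPl xL).
have FI x : L <= x -> F x = Jmx n *m adjmx beta.
  by move=> Lx; rewrite /F (min_idPr Lx) /K mulmxA UL.2 mul1mx.
clearbody F.
have bF x : L <= x -> beta *m F x = 0 by move=> Lx; rewrite FI// mulmxA.
have cF a b : 0 <= a -> mAC a b F.
  move=> a0; apply: (@mACS _ _ _ 0 (Num.max b L)) => //; first by rewrite le_max lexx.
  apply: (@mAC_glue _ _ _ _ L); first exact: ltW.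
  - by rewrite le_max lexx orbT.
  - apply: (@mAC_eq _ _ _ _ _ (fun x => U x *m K)) => [x /andP[_ xL]|]; first by rewrite FL.
    by apply: mAC_mulmx; [exact: cU|exact: mAC_cst].
  - apply: (@mAC_eq _ _ _ _ _ (fun=> Jmx n *m adjmx beta)) => [x /andP[Lx _]|].
      by rewrite FI.
    exact: mAC_cst.
have dFL : {ae mu, forall x : R, 0 < x < L -> mderiv F x (Jmx n *m (H x *m (z *: F x)))}.
  move: dU; apply: ae_mono => x h xL.
  have := mderiv_mulmx (h xL) (mderiv_cst K x).
  rewrite mulmx0 addr0 FL; last by case/andP: xL => _ /ltW.
  rewrite -!mulmxA -scalemxAl; apply: (mderiv_near (c := 0) (d := L) xL).
  by move=> t /andP[_ /ltW tL]; rewrite FL.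
have dF0 : {ae mu, forall x : R, 0 < x -> mderiv F x (Jmx n *m (H x *m (z *: F x)))}.
  have : {ae mu, forall x, D0 x -> mderiv F x (Jmx n *m (H x *m (z *: F x)))}.
    apply: ae_split; first by move: dFL; apply: ae_mono => x h; rewrite DLE.
    apply: aeW => x; rewrite DIE => Lx.
    rewrite tail_null ?mulmx0//; last by rewrite -scalemxAr bF ?scaler0// ltW.
    apply: (mderiv_near (c := L) (d := x + 1) _ _ (mderiv_cst (Jmx n *m adjmx beta) x)).
      by rewrite Lx ltrDl ltr01.
    by move=> t /andP[/ltW Lt _]; rewrite FI.
  by apply: ae_mono => x h x0; apply: h; rewrite D0E.
have cFc a b (c : 'cV[C]_n) : 0 <= a -> mAC a b (fun x => F x *m c).
  by move=> a0; apply: mAC_mulmx; [exact: cF|exact: mAC_cst].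
have L2F (c : 'cV[C]_n) : L2H D0 H (fun x => F x *m c).
  apply: L2H_AC => [b _|x Lx]; first exact: cFc.
  by rewrite mulmxA bF ?mul0mx// ltW.
have mFc (c : 'cV[C]_n) : mmeas D0 (fun x => F x *m c) by exact/mmeas_col/(L2F c).1.
have sumF (c : 'I_n -> C) x : \sum_j c j *: col j (F x) = F x *m \col_j c j.
  apply/matrixP => i k; rewrite summxE mxE; apply: eq_bigr => j _.
  by rewrite !mxE mulrC.
exists (fun j x => col j (F x)); split.
- move=> j; have E : (fun x => col j (F x)) = (fun x => F x *m delta_mx j 0).
    by apply/funext => x; rewrite colE.
  rewrite E; split; first exact: L2F.
  split.
    apply: (@eq_L2H _ _ _ H (fun x => F x *m (z *: delta_mx j 0))); last exact: L2F.
    by move=> x _; rewrite -scalemxAr colE.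
  exists (fun x => F x *m delta_mx j 0); split.
  - by move=> a b a0 _; apply: cFc; exact: ltW.
  - apply/(Hequiv_ae m0 mH0 p0 (mFc _) (mFc _)); exact: aeW.
  - apply/canon_eqE; move: dF0; apply: ae_mono => x h; rewrite D0E => /h d.
    have := mderiv_mulmx d (mderiv_cst (delta_mx j 0 : 'cV[C]_n) x).
    by congr mderiv; rewrite mulmx0 addr0 -!mulmxA -scalemxAl colE.
- move=> c; rewrite [X in Hnull _ _ X](_ : _ = fun x => F x *m \col_j c j); last first.
    by apply/funext => x; exact: sumF.
  set cc := \col_j c j => /(Hnull_ae m0 mH0 p0 (mFc cc)) nF.
  (* A combination of norm zero satisfies [H x *m (F x *m cc) = 0] a.e., so the equation makes its
     derivative zero. It is then a constant vector annihilated by [H] on (0, L), to which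
     definiteness applies. *)
  have const x : 0 < x < L -> F x *m cc = F L *m cc.
    move=> /andP[x0 xL]; apply/esym; apply: (@mAC_const _ _ _ x L (fun t => F t *m cc)).
    + exact: ltW.
    + by apply: cFc; exact: ltW.
    + have := ae_and nF dF0; apply: ae_mono => t [h1 h2] /andP[xt tL].
      have t0 : 0 < t by exact: lt_trans xt.
      have := mderiv_mulmx (h2 t0) (mderiv_cst cc t).
      rewrite mulmx0 addr0 -!mulmxA -scalemxAl -scalemxAr h1 ?D0E//.
      by rewrite scaler0 mulmx0.
  have z0 : F L *m cc = 0.
    apply: defH; move: nF; apply: ae_mono => x h Dx.
    have xL : 0 < x < L by rewrite -DLE.
    by rewrite -(const x xL) h//; exact: subL.
  have cc0 : cc = 0.
    have E : - (beta *m Jmx n) *m (Jmx n *m adjmx beta) = 1%:M.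
      rewrite mulNmx mulmxA -(mulmxA beta) Jmx_sq mulmxN mulmx1 mulNmx opprK.
      exact: bb.
    have := congr1 (mulmx (- (beta *m Jmx n))) z0.
    by rewrite FI// mulmxA E mul1mx mulmx0.
  by move=> j; have /matrixP/(_ j 0) := cc0; rewrite !mxE.
- move=> f [Lf [_ [f0 [cf0 ef0 df0]]]].
  have mf : mmeas D0 f by exact/mmeas_col/Lf.1.
  have mf0 := AC_meas0 cf0.
  have fe := (Hequiv_ae m0 mH0 p0 mf mf0).1 ef0.
  have df : {ae mu, forall x : R, 0 < x -> mderiv f0 x (Jmx n *m (H x *m (z *: f0 x)))}.
    move/canon_eqE : df0 => h; have := ae_and fe h; apply: ae_mono => x [h1 h2] x0.
    have Dx : D0 x by rewrite D0E.
    have := h2 Dx; congr mderiv; congr (_ *m _).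
    by rewrite -!scalemxAr h1.
  have bc x : L <= x -> beta *m f0 x = beta *m f0 L.
    move=> Lx; apply: (beta_const (lexx L) Lx _ df0); exact: cf0.
  have bf0 : beta *m f0 L = 0.
    apply: (@tail_L2 f0) => [x Lx|]; first by apply: bc; exact: ltW.
    exact: (L2H_sub m0 mH0 p0 mI subI (L2H_ae m0 mH0 p0 mf0 fe Lf)).
  have fI x : L <= x -> f0 x = f0 L.
    move=> Lx; apply: (mAC_const Lx (cf0 L x L0 Lx)).
    move: df; apply: ae_mono => t h /andP[Lt _].
    have := h (lt_trans L0 Lt); rewrite tail_null ?mulmx0//.
    by rewrite -scalemxAr bc ?bf0 ?scaler0// ltW.
  (* The coefficients that [ker_beta] gives for [f0 L] in terms of the columns of
     [Jmx n *m adjmx beta]. *)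
  pose cc := - (beta *m Jmx n *m f0 L).
  have fL : f0 L = F L *m cc by rewrite FI// -ker_beta.
  have fF x : 0 < x -> f0 x = F x *m cc.
    move=> x0; have [Lx|/ltW xL] := leP L x.
      by rewrite fI// fL !FI.
    (* Both solutions have constant Wronskian with [V] on [[x, L]] and agree at [L], so their
       Wronskians agree at [x]. Staying on [[x, L]] is essential, as [f0] is absolutely continuous
       only away from 0. *)
    apply/subr0_eq; apply: (VJinj x); first by rewrite xL ltW.
    rewrite mulmxBr mulmxBr.
    have W1 := @wronskian_const _ _ z f0 V x L (ltW x0) xL (lexx L) (cf0 x L x0 xL) (cV _ _).
    have W2 := @wronskian_const _ _ z (fun x => F x *m cc) V x L (ltW x0) xL (lexx L)
      (cFc x L cc (ltW x0)) (cV _ _).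
    have dfL : {ae mu, forall x : R, 0 < x < L ->
        mderiv f0 x (Jmx n *m (H x *m (z *: f0 x)))}.
      by move: df; apply: ae_mono => t h /andP[/h].
    have dFL' : {ae mu, forall x : R, 0 < x < L ->
        mderiv (fun x => F x *m cc) x (Jmx n *m (H x *m (z *: (F x *m cc))))}.
      move: dF0; apply: ae_mono => t h /andP[/h d _].
      have := mderiv_mulmx d (mderiv_cst cc t).
      by congr mderiv; rewrite mulmx0 addr0 -!mulmxA -scalemxAl.
    by rewrite -(W1 dfL dV) -(W2 dFL' dV) fL subrr.
  exists (fun j => cc j 0).
  rewrite [X in Hequiv _ _ _ X](_ : _ = fun x => F x *m \col_j cc j 0); last first.
    by apply/funext => x; exact: sumF.
  have -> : \col_j cc j 0 = cc by apply/matrixP => i j; rewrite mxE ord1.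
  apply/(Hequiv_ae m0 mH0 p0 mf (mFc cc)); move: fe; apply: ae_mono => x h Dx.
  by rewrite h// fF// -D0E.
Qed.

End TailWeight.

Theorem theorem6p1 (R : realType) (n : nat) (H : R -> 'M[R[i]]_(n + n))
    (alpha beta : 'M[R[i]]_(n, n + n)) (L : R) :
  loc_integrable_0oo H ->
  {ae (@lebesgue_measure R), forall x, 0 < x -> psdmx (H x)} ->
  regular_endpoint0 H ->
  alpha *m adjmx alpha = 1%:M -> beta *m adjmx beta = 1%:M ->
  alpha *m Jmx n *m adjmx alpha = 0 -> beta *m Jmx n *m adjmx beta = 0 ->
  0 < L ->
  (forall x, L < x -> H x =
     block_mx (adjmx (lsubmx beta) *m lsubmx beta) (adjmx (lsubmx beta) *m rsubmx beta)
              (adjmx (rsubmx beta) *m lsubmx beta) (adjmx (rsubmx beta) *m rsubmx beta)) ->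
  (* S = S^{alpha,beta}(0,L) (+) {(0,g) : g in L^2_H(L,oo)} *)
  (forall f g, L2H `]0, +oo[ H f -> L2H `]0, +oo[ H g ->
     Srel H alpha f g <-> Sab H alpha beta L f g /\ Hnull `]L, +oo[ H f) /\
  (definite_on `]0, L[ H ->
   [/\ deficiency_index H 'i n /\ deficiency_index H (- 'i) n,
       (* operator parts coincide (L^2_H(0,L) embedded by extension by 0) *)
       forall f g, L2H `]0, +oo[ H f -> L2H `]0, +oo[ H g ->
         op_part `]0, +oo[ H (Srel H alpha) f g <->
         [/\ op_part `]0, L[ H (Sab H alpha beta L) f g,
             Hnull `]L, +oo[ H f & Hnull `]L, +oo[ H g]
     & (* m functions coincide *)
       forall (z : R[i]), complex.Im z != 0 ->
       forall u v : R -> 'M[R[i]]_(n + n, n),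
         msol H z (- (Jmx n *m adjmx alpha)) u -> msol H z (adjmx alpha) v ->
         forall M : 'M[R[i]]_n, is_m_S H u v M <-> is_m_Sab beta L u v M]).
Proof.
move=> locH psdH regH _ bb _ bJb L0 HLb.
have HL x : L < x -> H x = adjmx beta *m beta.
  move=> Lx; rewrite (HLb x Lx) -mul_col_row hsubmxK; congr (_ *m _).
  by rewrite -[in RHS](hsubmxK beta) /adjmx map_row_mx tr_row_mx.
split=> [f g Lf Lg|defH].
  split=> [Sfg|[Sfg nf]].
    exact: (Srel_Sab locH psdH bJb L0 HL Sfg).
  exact: (Sab_Srel locH psdH bJb L0 HL Lf Lg Sfg nf).
split.
- by split; exact: (deficiency locH psdH regH bb bJb L0 HL).
- move=> f g Lf Lg; exact: (op_part_iff _ locH psdH bJb L0 HL Lf Lg).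
- move=> z _ u v su sv M.
  (* The two conditions agree for every matrix [M'], so the uniqueness clauses correspond as
     well. *)
  have P M' := m_function_iff locH psdH regH bJb L0 HL M' su sv.
  by split=> -[/P h1 h2]; split => // M' /P; exact: h2.
Qed.
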